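(* (a) The diagram of the $3$-transposition group $\operatorname{P}\Omega_8^+(2){:}\operatorname{Sym}(3)$ has size $n=360$ and spectrum $$((\,296;\ [-64]^2,\ [8]^{105},\ [-4]^{252}\,)).$$ (b) The diagram of the $3$-transposition group $\operatorname{P}\Omega_8^+(3){:}\operatorname{Sym}(3)$ has size $n=3240$ and spectrum $$((\,2888;\ [-352]^2,\ [8]^{2457},\ [-28]^{780}\,)).$$
   Context: A $3$-transposition group $(G,D)$ is a group $G$ generated by a conjugacy class $D$ of elements of order $2$ such that $|de|\in\{1,2,3\}$ for all $d,e\in D$. Its diagram is the graph with vertex set $D$ in which $d,e$ are adjacent iff $|de|=3$; its size is $n=|D|$. The spectrum is that of the $(0,1)$-adjacency matrix, written $((k;\dots,[r]^c,\dots))$: first the degree $k$ of the (regular) diagram, counted once, then the remaining eigenvalues, $[r]^c$ meaning $r$ with multiplicity $c$. For $q\in\{2,3\}$, $\operatorname{P}\Omega_8^+(q){:}\operatorname{Sym}(3)$ is the split extension of the simple group $\operatorname{P}\Omega_8^+(q)$ by its group $\operatorname{Sym}(3)$ of (triality) graph automorphisms. It is a $3$-transposition group whose generating class $D$ (unique up to automorphism) is the conjugacy class meeting the subgroup $\operatorname{P}\Omega_8^+(q){:}\operatorname{Sym}(2)$ in the image of the class of orthogonal transvections with nonsingular center (if $q=2$), respectively of a class of reflections with centers $\langle x\rangle$, $(x,x)=1$ (if $q=3$). *)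

(* Defs.v *)
From HB Require Import structures.
From mathcomp Require Import all_boot all_order all_fingroup all_algebra.
From mathcomp Require Import all_solvable all_field.

Set Implicit Arguments.
Unset Strict Implicit.
Unset Printing Implicit Defensive.

Import GroupScope GRing.Theory.

Definition three_transposition_group (gT : finGroupType)
    (G : {group gT}) (D : {set gT}) : Prop :=
  [/\ D \in classes G,
      <<D>> = G,
      {in D, forall d, #[d] = 2%N}
    & {in D &, forall d e, #[d * e] \in [:: 1; 2; 3]%N}].

Section Diagram.

Variables (gT : finGroupType) (D : {set gT}).

Definition adj (d e : gT) : bool := #[d * e] == 3%N.

Definition adjmx : 'M[algC]_#|D| :=
  (\matrix_(i, j) (adj (enum_val i) (enum_val j))%:R)%R.

(* The spectrum ((k; ..., [r]^c, ...)) of the diagram, where s lists the pairs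
   (r, c): the diagram is regular of degree k, and k (once) together with the
   r (c times each) are all the eigenvalues, counted with multiplicity. *)
Definition diagram_spectrum (k : nat) (s : seq (algC * nat)) : Prop :=
  {in D, forall d, #|[set e in D | adj d e]| = k} /\
  char_poly adjmx =
    (('X - k%:R%:P) * \prod_(rc <- s) ('X - rc.1%:P) ^+ rc.2)%R.

End Diagram.

(* The orthogonal space of plus type of dimension 8 = 4 + 4 over 'F_q, with
   hyperbolic basis e_0 .. e_3, f_0 .. f_3.  Matrices act on row vectors on
   the right. *)
Section Orthogonal.

Variable q : nat.

Local Notation V := 'rV['F_q]_(4 + 4).
Local Notation GL8 := {'GL_8['F_q]}.

Definition act8 (g : GL8) (v : V) : V := (v *m GLval g)%R.

Definition Q (v : V) : 'F_q :=
  (\sum_(i < 4) v 0 (lshift 4 i) * v 0 (rshift 4 i))%R.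

(* The polar form of Q, so that (x, x) = 2 Q(x). *)
Definition form (v w : V) : 'F_q := (Q (v + w) - Q v - Q w)%R.

Definition GO8 : {set GL8} := [set g | [forall v, Q (act8 g v) == Q v]].

(* For q = 2, 3 the derived subgroup of GO8 is the usual Omega_8^+(q): it has
   index 2, resp. 4, in GO8, and its quotient by its center is simple. *)
Definition Omega8 : {group GL8} := [~: GO8, GO8]%G.

Definition POmega8 : {group coset_of 'Z(Omega8)} := (Omega8 / 'Z(Omega8))%G.

Definition reflection_center (x : V) : bool :=
  if q == 2%N then Q x != 0%R else form x x == 1%R.

(* For q = 2 these are the orthogonal transvections w |-> w + (w, x) x. *)
Definition reflections : {set GL8} :=
  [set r | [exists x : V, reflection_center x &&
     [forall w : V, act8 r w == (w - (form w x / Q x) *: x)%R]]].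

(* POmega8 : Sym(2), the image of the orthogonal group generated by Omega8 and
   the reflections. *)
Definition POmega8_Sym2 : {group coset_of 'Z(Omega8)} :=
  ((Omega8 <*> reflections) / 'Z(Omega8))%G.

Definition hyp_e (i : 'I_4) : V := delta_mx 0%R (lshift 4 i).
Definition hyp_f (i : 'I_4) : V := delta_mx 0%R (rshift 4 i).

(* Nodes of the Dynkin diagram D_4: node 1 is the central one, joined to
   0, 2 and 3.  The simple roots are eps_0 - eps_1, eps_1 - eps_2,
   eps_2 - eps_3 and eps_2 + eps_3. *)
Definition node (k : nat) : 'I_4 := inord k.

(* Diagram automorphisms: the permutations of the nodes fixing the center. *)
Definition AutD4 : {group {perm 'I_4}} := 'C[node 1 | 'P]%G.

(* The pair (u, v) of singular vectors for which the root element x_r(t) is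
   w |-> w + t (w, v) u - t (w, u) v, where r is the simple root attached to
   the node i if pos holds, and the opposite of that root otherwise. *)
Definition root_pair (i : 'I_4) (pos : bool) : V * V :=
  if i == node 3 then
    if pos then (hyp_e (node 2), hyp_e (node 3))
           else (hyp_f (node 3), hyp_f (node 2))
  else
    let j : 'I_4 := inord i.+1 in
    if pos then (hyp_e i, hyp_f j) else (hyp_e j, hyp_f i).

Definition is_root_element (i : 'I_4) (pos : bool) (t : 'F_q) (g : GL8) :=
  let: (u, v) := root_pair i pos in
  forall w : V,
    act8 g w = (w + (t * form w v) *: u - (t * form w u) *: v)%R.

End Orthogonal.

Arguments act8 {q}.
Arguments Q {q}.
Arguments form {q}.
Arguments is_root_element {q}.

(* G is the split extension POmega8 q : Sym(3) of POmega8 q, embedded by psi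
   with image N, by a complement S.  Through gam, S is the group of graph
   automorphisms: gam p maps x_r(t) to x_(p r)(t) for r a simple root or the
   opposite of one (these elements generate POmega8 q).  The map psi also
   identifies POmega8_Sym2 q, which contains the reflections, with N : Sym(2),
   where Sym(2) interchanges the nodes 2 and 3. *)
Record POmega8_Sym3 (q : nat) (gT : finGroupType) (G : {group gT}) := {
  normal_part : {group gT};
  graph_part : {group gT};
  split_ext : normal_part ><| graph_part = G;
  psi : {morphism POmega8_Sym2 q >-> gT};
  psi_inj : 'injm psi;
  psi_POmega8 : psi @* POmega8 q = normal_part;
  gam : {morphism AutD4 >-> gT};
  gam_isom : isom AutD4 graph_part gam;
  gam_graph : forall (p : {perm 'I_4}) (i : 'I_4) (pos : bool) (t : 'F_q)
      (g h : {'GL_8['F_q]}),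
    p \in AutD4 -> g \in Omega8 q -> h \in Omega8 q ->
    is_root_element i pos t g -> is_root_element (p i) pos t h ->
    psi (coset 'Z(Omega8 q) g) ^ gam p = psi (coset 'Z(Omega8 q) h);
  psi_POmega8_Sym2 :
    psi @* POmega8_Sym2 q = normal_part <*> <[gam (tperm (node 2) (node 3))]>
}.

(* D meets the subgroup POmega8 q : Sym(2) in the image of the reflections. *)
Definition reflection_class (q : nat) (gT : finGroupType) (G : {group gT})
    (E : POmega8_Sym3 q G) (D : {set gT}) : Prop :=
  D \in classes G /\
  D :&: psi E @* POmega8_Sym2 q = psi E @* (reflections q / 'Z(Omega8 q)).

(* Main.v *)
(** Each element of [D] maps to one of the three transpositions of Sym(3), so
    [D] is a union of three conjugate fibres.  Elements of different fibres have
    a product that maps to a 3-cycle, hence are always adjacent; each fibre is a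
    copy of the image of the reflections in the orthogonal group.  For q = 2, 3
    both kinds of reflections are w |-> w + (w, x) x with Q x = -1, and distinct
    ones are adjacent iff their centers are not orthogonal.  Character sums over
    F_q count the common neighbours, which shows that a fibre is strongly
    regular.  The diagram is the join of three copies of this strongly regular
    graph; this determines its four eigenvalues, and their multiplicities follow
    from the traces of the first powers of the adjacency matrix. *)

From mathcomp Require Import all_boot all_order all_fingroup all_algebra.
From mathcomp Require Import all_solvable all_field.
From mathcomp Require Import ring zify.
Require Import Defs.

Set Implicit Arguments.
Unset Strict Implicit.
Unset Printing Implicit Defensive.

Import GRing.Theory Num.Theory.

(** * Character sums on the quadric Q = -1 *)

(** The class [D] only sees reflections modulo the center of [Omega8], so distinct reflections must
    be shown to stay distinct there. That center is never computed: a central product [r x * r y] is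
    shown to commute with every reflection, which forces [x] and [y] to be proportional. The
    auxiliary vectors of that argument exist because the counts on the quadric leave room for them,
    so the same few numbers yield both the strongly regular parameters and the faithfulness of the
    quotient. In the join, the all-ones matrix and the same-fibre matrix account for the eigenvalues
    k + 2n and k - n. On vectors killed by both, the adjacency matrix satisfies the quadratic
    equation of one fibre, with roots r and s. These four values are distinct, so the traces of the
    powers 0 to 3 form a Vandermonde system for the multiplicities. *)

Section AdditiveCharacter.

Local Open Scope ring_scope.

Variables (p : nat) (zeta : algC).
Hypotheses (p_pr : prime p) (zetaP : p.-primitive_root zeta).

Definition chi (a : 'F_p) : algC := zeta ^+ a.

Lemma chi0 : chi 0 = 1.
Proof. by rewrite /chi expr0. Qed.

Lemma chiD : {morph chi : a b / a + b >-> a * b}.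
Proof.
move=> a b; rewrite /chi -exprD -(prim_expr_mod zetaP (a + b)) /=.
by rewrite [X in (_ %% X)%N](Fp_cast p_pr).
Qed.

Lemma chi_neq1 a : a != 0 -> chi a != 1.
Proof.
move=> a0; rewrite /chi -(prim_order_dvd zetaP) gtnNdvd //.
  by rewrite lt0n.
by have := ltn_ord a; rewrite [X in (_ < X)%N -> _](Fp_cast p_pr).
Qed.

(** Translation by [u0] multiplies the sum by [chi (f u0)], which differs from 1. *)
Lemma sum_chi_eq0 (U : finZmodType) (f : U -> 'F_p) (u0 : U) :
  {morph f : u v / u + v} -> f u0 != 0 -> \sum_u chi (f u) = 0.
Proof.
move=> fD /chi_neq1 nz; apply/eqP.
have : chi (f u0) * (\sum_u chi (f u)) = \sum_u chi (f u).
  rewrite [RHS](reindex_inj (addrI u0)) mulr_sumr.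
  by apply: eq_bigr => u _; rewrite fD chiD.
move/eqP; rewrite -subr_eq0 -[X in _ - X]mul1r -mulrBl mulf_eq0.
by rewrite subr_eq0 (negPf nz).
Qed.

(** Orthogonality of characters: the sum over [t] detects the equation [c = 0], which is how the
    counts below impose their conditions. *)
Lemma sum_chi_mul (c : 'F_p) : \sum_t chi (t * c) = (p * (c == 0))%:R.
Proof.
have [->|c0] := eqVneq c 0.
  rewrite muln1 (eq_bigr (fun=> 1)) => [|t _]; last by rewrite mulr0 chi0.
  by rewrite sumr_const card_Fp.
rewrite muln0 (@sum_chi_eq0 _ _ 1) ?mul1r // => u v; exact: mulrDl.
Qed.

End AdditiveCharacter.

(** * The hyperbolic quadratic form and its polar form *)

Section QuadraticForm.

Local Open Scope ring_scope.

Variable q : nat.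
Local Notation V := 'rV['F_q]_(4 + 4).

Lemma formE (v w : V) : form v w =
  \sum_(i < 4) (v 0 (lshift 4 i) * w 0 (rshift 4 i)
                + v 0 (rshift 4 i) * w 0 (lshift 4 i)).
Proof.
rewrite /form /Q -!sumrB; apply: eq_bigr => i _; rewrite !mxE; ring.
Qed.

Lemma QD (v w : V) : Q (v + w) = Q v + Q w + form v w.
Proof. by rewrite /form; ring. Qed.

Lemma QZ a (v : V) : Q (a *: v) = a ^+ 2 * Q v.
Proof.
rewrite /Q mulr_sumr; apply: eq_bigr => i _; rewrite !mxE; ring.
Qed.

Lemma Q0 : Q (0 : V) = 0.
Proof. by rewrite -(scale0r (0 : V)) QZ expr0n mul0r. Qed.

Lemma formC (v w : V) : form v w = form w v.
Proof. by rewrite /form [w + v]addrC; ring. Qed.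

Lemma formDl (u v w : V) : form (u + v) w = form u w + form v w.
Proof.
rewrite !formE -big_split; apply: eq_bigr => i _; rewrite !mxE /=; ring.
Qed.

Lemma formZl a (v w : V) : form (a *: v) w = a * form v w.
Proof.
rewrite !formE mulr_sumr; apply: eq_bigr => i _; rewrite !mxE /=; ring.
Qed.

Lemma formDr (u v w : V) : form w (u + v) = form w u + form w v.
Proof. by rewrite ![form w _]formC formDl. Qed.

Lemma formZr a (v w : V) : form w (a *: v) = a * form w v.
Proof. by rewrite ![form w _]formC formZl. Qed.

Lemma form0l (w : V) : form 0 w = 0.
Proof. by rewrite -(scale0r (0 : V)) formZl mul0r. Qed.

Lemma formxx (v : V) : form v v = 2%:R * Q v.
Proof.
rewrite formE /Q mulr_sumr; apply: eq_bigr => i _; ring.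
Qed.

(** Pairing with a hyperbolic basis vector reads off a coordinate in the opposite half;
    nondegeneracy follows. *)
Lemma form_deltar (v : V) (i : 'I_4) :
  form v (delta_mx 0 (rshift 4 i)) = v 0 (lshift 4 i).
Proof.
rewrite formE (bigD1 i) //= big1 => [|j ji]; rewrite !mxE /= ?eqxx.
  by rewrite eq_lrshift mulr1 mulr0 !addr0.
by rewrite eq_rshift (negPf ji) eq_lrshift !mulr0 addr0.
Qed.

Lemma form_deltal (v : V) (i : 'I_4) :
  form v (delta_mx 0 (lshift 4 i)) = v 0 (rshift 4 i).
Proof.
rewrite formE (bigD1 i) //= big1 => [|j ji]; rewrite !mxE /= ?eqxx.
  by rewrite eq_rlshift mulr1 mulr0 !addr0 add0r.
by rewrite eq_lshift (negPf ji) eq_rlshift !mulr0 addr0.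
Qed.

Lemma form_nondeg (v : V) : v != 0 -> exists w, form v w != 0.
Proof.
move=> v0; apply/existsP; apply: contraNT v0 => /existsPn nw.
have {nw} vw0 w : form v w = 0 by apply/eqP/negbNE/nw.
apply/eqP/rowP => j; rewrite mxE.
case: (split_ordP j) => i ->.
  by rewrite -form_deltar vw0.
by rewrite -form_deltal vw0.
Qed.

End QuadraticForm.

(** * Fourier transform of the indicator function of the quadric *)

Section SphereSums.

Local Open Scope ring_scope.

Variables (q : nat) (zeta : algC).
Hypotheses (q_pr : prime q) (zetaP : q.-primitive_root zeta).
(* Holds exactly for q = 2, 3; it replaces the Kloosterman sums of the general
   case by ordinary ones. *)
Hypothesis sq1 : forall t : 'F_q, t != 0 -> t * t = 1.

Local Notation V := 'rV['F_q]_(4 + 4).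
Local Notation chi := (chi zeta).

Lemma card_rV_Fp n : #|{: 'rV['F_q]_n}| = (q ^ n)%N.
Proof. by rewrite card_mx card_Fp // mul1n. Qed.

Lemma sum_chi_form (w : V) :
  \sum_z chi (form w z) = (q ^ 8 * (w == 0))%:R.
Proof.
have [->|/form_nondeg[z wz]] := eqVneq w 0.
  rewrite muln1 (eq_bigr (fun=> 1)) => [|z _]; last by rewrite form0l chi0.
  by rewrite sumr_const card_rV_Fp.
rewrite muln0 (sum_chi_eq0 q_pr zetaP _ wz) // => u v; exact: formDr.
Qed.

(** Split the coordinates into halves a and b. For fixed a the summand is a character in b,
    nontrivial unless a = 0, so only a = 0 contributes, once for each b. *)
Lemma sum_chi_Q (t : 'F_q) : t != 0 ->
  \sum_(z : V) chi (t * Q z) = (q ^ 4)%:R.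
Proof.
move=> t0; pose h (ab : 'rV['F_q]_4 * 'rV['F_q]_4) : V := row_mx ab.1 ab.2.
pose h' (v : V) := (lsubmx v, rsubmx v) : 'rV['F_q]_4 * 'rV['F_q]_4.
rewrite (reindex h) /=; last first.
  exists h' => [[a b] _|v _]; rewrite /h /h' /= ?row_mxKl ?row_mxKr //.
  exact: hsubmxK.
rewrite (eq_bigr (fun ab : 'rV['F_q]_4 * 'rV['F_q]_4 =>
  chi (\sum_i t * ab.1 0 i * ab.2 0 i))); last first.
  move=> [a b] _; congr chi; rewrite /Q mulr_sumr; apply: eq_bigr => i _.
  by rewrite /h row_mxEl row_mxEr mulrA.
rewrite -(pair_bigA _ (fun a b : 'rV['F_q]_4 =>
  chi (\sum_i t * a 0 i * b 0 i))) /=.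
rewrite (bigD1 0) //= addrC big1 ?add0r.
  rewrite (eq_bigr (fun=> 1)) => [|b _].
    by rewrite sumr_const card_rV_Fp.
  by rewrite big1 ?chi0 // => i _; rewrite mxE mulr0 mul0r.
move=> a a0; have [i ai0] : exists i, a 0 i != 0.
  apply/existsP; apply: contraNT a0 => /existsPn a0; apply/eqP/rowP => i.
  by rewrite mxE; apply/eqP/negbNE/a0.
rewrite (@sum_chi_eq0 _ _ q_pr zetaP _ _ (delta_mx 0 i)) //.
  move=> u v; rewrite -big_split; apply: eq_bigr => j _.
  by rewrite mxE /= mulrDr.
rewrite (bigD1 i) //= big1 => [|j ji]; rewrite !mxE !eqxx /=.
  by rewrite addr0 mulr1 mulf_neq0.
by rewrite (negPf ji) mulr0.
Qed.

Definition sphere_sum (w : V) : algC := \sum_(z | Q z == -1) chi (form w z).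

(** After multiplication by q the condition Q z = -1 becomes a sum over t of [chi (t * (Q z + 1))].
    The term t = 0 only contributes at w = 0; each other t contributes q^4 [chi (t * (1 - Q w))]. *)
Lemma sphere_sumE (w : V) : sphere_sum w =
  (q ^ 7 * (w == 0) + q ^ 4 * (Q w == 1))%:R - (q ^ 3)%:R.
Proof.
have q0 : (q%:R : algC) != 0 by rewrite pnatr_eq0 -lt0n prime_gt0.
apply: (mulfI q0); rewrite /sphere_sum mulr_sumr big_mkcond /=.
transitivity (\sum_t \sum_(z : V) chi (t + (t * Q z + form w z))).
  rewrite exchange_big; apply: eq_bigr => z _ /=.
  rewrite (eq_bigr (fun t => chi (t * (Q z + 1)) * chi (form w z))).
    rewrite -mulr_suml sum_chi_mul // addr_eq0; case: eqP => _.
      by rewrite muln1.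
    by rewrite muln0 mul0r.
  by move=> t _; rewrite -chiD //; congr chi; ring.
rewrite (bigD1 0) //=.
rewrite [X in X + _](eq_bigr (fun z => chi (form w z))) => [|z _]; last first.
  by congr chi; ring.
rewrite sum_chi_form.
rewrite (eq_bigr (fun t => (q ^ 4)%:R * chi (t * (1 - Q w)))); last first.
  move=> t t0; rewrite -(sum_chi_Q t0) mulr_suml.
  (* Completing the square: since 1/t = t, the shift z - t w turns t Q z + (w, z) into t Q z - t Q
     w. *)
  rewrite (reindex_inj (addIr (- (t *: w)))); apply: eq_bigr => z _.
  rewrite -chiD //; congr chi.
  rewrite QD -scaleNr formDr formZr !QZ formZr formxx [form z w]formC.
  have tE := sq1 t0; ring: tE.
rewrite -mulr_sumr.
have := sum_chi_mul q_pr zetaP (1 - Q w); rewrite (bigD1 0) //= mul0r chi0.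
move/(canRL (addKr _)) => ->; rewrite subr_eq0 [1 == _]eq_sym.
by rewrite !natrD !natrM; ring.
Qed.

Lemma card_sphere : #|[set z : V | Q z == -1]|%:R = sphere_sum 0.
Proof.
rewrite -sum1dep_card natr_sum; apply: eq_bigr => z _.
by rewrite form0l chi0.
Qed.

(** Averaging [chi (s * form x z)] over s imposes orthogonality to x; exchanging the sums leaves
    Fourier coefficients along the line of x. Two conditions give the plane of x and y in the same
    way. *)
Lemma card_sphere_perp (x : V) :
  (q * #|[set z : V | (Q z == -1) && (form x z == 0)]|)%:R =
  \sum_s sphere_sum (s *: x).
Proof.
rewrite /sphere_sum exchange_big /= -sum1dep_card big_mkcondr big_distrr.
rewrite natr_sum /=; apply: eq_bigr => z _.
rewrite (eq_bigr (fun s => chi (s * form x z))) => [|s _].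
  by rewrite sum_chi_mul //; case: eqP.
by rewrite formZl.
Qed.

Lemma card_sphere_perp2 (x y : V) :
  (q ^ 2 * #|[set z : V | [&& Q z == -1, form x z == 0 & form y z == 0]]|)%:R =
  \sum_s \sum_t sphere_sum (s *: x + t *: y).
Proof.
rewrite (eq_bigr _ (fun s _ => exchange_big _ _ _ _ _ _)) /=.
rewrite exchange_big /= -sum1dep_card big_mkcondr big_distrr.
rewrite natr_sum /=; apply: eq_bigr => z _.
rewrite (eq_bigr (fun s => chi (s * form x z) * \sum_t chi (t * form y z))).
  rewrite -mulr_suml !sum_chi_mul // -natrM; congr (_%:R).
  by do 2!case: eqP => _ //=; rewrite ?muln0 ?muln1 ?mul0n // mulnn.
move=> s _; rewrite mulr_sumr; apply: eq_bigr => t _.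
by rewrite -chiD // formDl !formZl.
Qed.

End SphereSums.

Section Proportional.

Local Open Scope ring_scope.

(** When all nonzero scalars square to 1, this says that two nonzero vectors span the same line; in
    characteristic 2 the two alternatives coincide. *)
Definition proportional (V : zmodType) (x y : V) := (y == x) || (y == - x).

Lemma proportionalP (F : fieldType) (V : lmodType F) (x y : V) :
  reflect (exists2 c : F, c * c = 1 & y = c *: x) (proportional x y).
Proof.
apply: (iffP orP) => [[] /eqP-> | [c /eqP]].
- by exists 1; rewrite ?mul1r ?scale1r.
- by exists (-1); rewrite ?mulrNN ?mul1r ?scaleN1r.
rewrite -expr2 sqrf_eq1 => /orP[] /eqP-> ->; first by left; rewrite scale1r.
by right; rewrite scaleN1r.
Qed.

End Proportional.

Section SphereCounts.

Local Open Scope ring_scope.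

Variable q : nat.
Hypothesis sq1 : forall t : 'F_q, t != 0 -> t * t = 1.
Local Notation V := 'rV['F_q]_(4 + 4).

Lemma sphere_neq0 (x : V) : Q x = -1 -> x != 0.
Proof.
by move=> Qx; apply: contra_eq_neq Qx => ->; rewrite Q0 eq_sym oppr_eq0 oner_eq0.
Qed.

Lemma independent (x y : V) (s t : 'F_q) : x != 0 -> y != 0 ->
  ~~ proportional x y -> s *: x + t *: y = 0 -> s = 0 /\ t = 0.
Proof.
move=> x0 y0 xy; have [-> | s0] := eqVneq s 0.
  by rewrite scale0r add0r => /eqP; rewrite scaler_eq0 (negPf y0) orbF => /eqP.
have [-> | t0] := eqVneq t 0.
  rewrite scale0r addr0 => /eqP.
  by rewrite scaler_eq0 (negPf x0) (negPf s0).
move=> st; case/negP: xy; apply/proportionalP; exists (- (s * t)).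
  by rewrite mulrNN mulrACA !sq1 // mul1r.
rewrite scaleNr mulrC -scalerA.
have /eqP -> : s *: x == - (t *: y) by rewrite -addr_eq0 st.
by rewrite scalerN opprK scalerA sq1 // scale1r.
Qed.

Definition sphere := [set z : V | Q z == -1].
Definition perp_pts (x : V) := [set z : V | (Q z == -1) && (form x z == 0)].
Definition perp_pts2 (x y : V) :=
  [set z : V | [&& Q z == -1, form x z == 0 & form y z == 0]].

(** The interface between the character sums and the geometry, common to both fields. *)
Definition sphere_counts (n c c0 c1 : nat) :=
  [/\ #|sphere| = n,
      forall x, Q x = -1 -> #|perp_pts x| = c
    & forall x y, Q x = -1 -> Q y = -1 -> ~~ proportional x y ->
        #|perp_pts2 x y| = if form x y == 0 then c0 else c1].

End SphereCounts.

(** * Explicit counts for q = 2 and q = 3 *)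

Section SmallFields.

Local Open Scope ring_scope.

Lemma sq1_F2 (t : 'F_2) : t != 0 -> t * t = 1.
Proof. by case: t => -[|[|]] //= i _; apply: val_inj. Qed.

Lemma sq1_F3 (t : 'F_3) : t != 0 -> t * t = 1.
Proof. by case: t => -[|[|[|]]] //= i _; apply: val_inj. Qed.

Lemma sum_F2 (R : nmodType) (f : 'F_2 -> R) : \sum_s f s = f 0 + f 1.
Proof.
rewrite !big_ord_recl big_ord0 addr0; congr (f _ + f _); exact: val_inj.
Qed.

Lemma sum_F3 (R : nmodType) (f : 'F_3 -> R) :
  \sum_s f s = f 0 + (f 1 + f (-1)).
Proof.
rewrite !big_ord_recl big_ord0 addr0.
by congr (f _ + (f _ + f _)); apply: val_inj.
Qed.

Lemma sum2_F2 (f : 'F_2 -> 'F_2 -> algC) :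
  \sum_s \sum_t f s t = f 0 0 + f 0 1 + (f 1 0 + f 1 1).
Proof. by rewrite !sum_F2. Qed.

Lemma sum2_F3 (f : 'F_3 -> 'F_3 -> algC) :
  \sum_s \sum_t f s t = f 0 0 + (f 0 1 + f 0 (-1)) +
    (f 1 0 + (f 1 1 + f 1 (-1)) + (f (-1) 0 + (f (-1) 1 + f (-1) (-1)))).
Proof. by rewrite !sum_F3. Qed.

Lemma F2P (P : 'F_2 -> Prop) : P 0 -> P 1 -> forall e, P e.
Proof.
move=> P0 P1 [[|[|e]] //= i].
  by rewrite (_ : Ordinal i = 0) //; apply: val_inj.
by rewrite (_ : Ordinal i = 1) //; apply: val_inj.
Qed.

Lemma F3P (P : 'F_3 -> Prop) : P 0 -> P 1 -> P (-1) -> forall e, P e.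
Proof.
move=> P0 P1 Pn1 [[|[|[|e]]] //= i].
- by rewrite (_ : Ordinal i = 0) //; apply: val_inj.
- by rewrite (_ : Ordinal i = 1) //; apply: val_inj.
by rewrite (_ : Ordinal i = -1) //; apply: val_inj.
Qed.

(** The Fourier coefficient is 120 at 0, 8 where [Q] is 1, and -8 at the other vectors. As Q (x + y)
    = (x, y), the plane of x and y contributes 120 + 8 + 8 - 8 if they are orthogonal and 120 + 8 +
    8 + 8 if not. *)
Lemma sphere_counts_F2 : sphere_counts 2 120 64 32 36.
Proof.
have [z zP] := C_prim_root_exists (isT : (0 < 2)%N).
have Tn0 (w : 'rV['F_2]_(4 + 4)) : w != 0 ->
  sphere_sum z w = (16 * (Q w == 1))%:R - 8%:R.
  by move=> w0; rewrite (sphere_sumE (isT : prime 2) zP sq1_F2) (negPf w0) muln0.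
have T0 : sphere_sum z (0 : 'rV['F_2]_(4 + 4)) = 120%:R.
  by rewrite (sphere_sumE (isT : prime 2) zP sq1_F2) eqxx Q0 -natrB.
have cast n a : (n%:R : algC) = a%:R -> n = a.
  by move/eqP; rewrite eqr_nat => /eqP.
split => [|x Qx|x y Qx Qy xy].
- by apply: cast; rewrite [LHS](card_sphere _ z) T0.
- suff: (2 * #|perp_pts x|)%N = 128%N by lia.
  apply: cast; rewrite [LHS](card_sphere_perp (isT : prime 2) zP) sum_F2.
  rewrite scale0r T0 scale1r Tn0 ?sphere_neq0 // Qx.
  by rewrite -natrB // -natrD.
have x0 := sphere_neq0 Qx; have y0 := sphere_neq0 Qy.
have xy0 : x + y != 0.
  apply/eqP => xy0; case: (@independent _ sq1_F2 x y 1 1) => //.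
  by rewrite !scale1r.
suff: (2 ^ 2 * #|perp_pts2 x y|)%N = if form x y == 0 then 128%N else 144%N.
  by case: eqP => _; lia.
apply: cast.
apply: etrans (card_sphere_perp2 (isT : prime 2) zP x y) _.
apply: etrans (sum2_F2 _) _.
rewrite !scale0r !scale1r !add0r !addr0 T0 !Tn0 // QD Qx Qy.
by elim/F2P: (form x y) => /=; ring.
Qed.

(** The Fourier coefficient is 2160 at 0, 54 where [Q] is 1, and -27 at the other vectors. The four
    vectors s x + t y with s, t nonzero all have [Q] equal to 1 if x and y are orthogonal; otherwise
    none has. *)
Lemma sphere_counts_F3 : sphere_counts 3 2160 702 252 216.
Proof.
have [z zP] := C_prim_root_exists (isT : (0 < 3)%N).
have Tn0 (w : 'rV['F_3]_(4 + 4)) : w != 0 ->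
  sphere_sum z w = (81 * (Q w == 1))%:R - 27%:R.
  by move=> w0; rewrite (sphere_sumE (isT : prime 3) zP sq1_F3) (negPf w0) muln0.
have T0 : sphere_sum z (0 : 'rV['F_3]_(4 + 4)) = 2160%:R.
  by rewrite (sphere_sumE (isT : prime 3) zP sq1_F3) eqxx Q0 -natrB.
have cast n a : (n%:R : algC) = a%:R -> n = a.
  by move/eqP; rewrite eqr_nat => /eqP.
have T1 (x : 'rV['F_3]_(4 + 4)) : Q x = -1 -> sphere_sum z x = - 27%:R.
  by move=> Qx; rewrite Tn0 ?sphere_neq0 // Qx sub0r.
have QN (x : 'rV['F_3]_(4 + 4)) : Q (- x) = Q x.
  by rewrite -scaleN1r QZ sqrrN expr1n mul1r.
split => [|x Qx|x y Qx Qy xy].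
- by apply: cast; rewrite [LHS](card_sphere _ z) T0.
- suff: (3 * #|perp_pts x|)%N = 2106%N by lia.
  apply: cast; apply: etrans (card_sphere_perp (isT : prime 3) zP x) _.
  apply: etrans (sum_F3 _) _.
  rewrite scale0r T0 scale1r scaleN1r !T1 ?QN //; ring.
have x0 := sphere_neq0 Qx; have y0 := sphere_neq0 Qy.
have n0 s t : s != 0 -> s *: x + t *: y != 0.
  by move=> s0; apply: contra_neqN s0 => /eqP /(independent sq1_F3 x0 y0 xy) [].
suff: (3 ^ 2 * #|perp_pts2 x y|)%N = if form x y == 0 then 2268%N else 1944%N.
  by case: eqP => _; lia.
apply: cast.
apply: etrans (card_sphere_perp2 (isT : prime 3) zP x y) _.
apply: etrans (sum2_F3 _) _.
have Tn s t : s != 0 -> t != 0 ->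
    sphere_sum z (s *: x + t *: y) =
    (81 * (-1 - 1 + s * t * form x y == 1))%:R - 27%:R.
  move=> s0 t0; rewrite Tn0 ?n0 // QD !QZ formZl formZr Qx Qy !expr2 !sq1_F3 //.
  by rewrite !mul1r mulrA.
rewrite !(scale0r, addr0, add0r) T0 !Tn // ?scaleN1r ?scale1r !T1 ?QN //.
by elim/F3P: (form x y) => /=; ring.
Qed.

End SmallFields.

(** * Reflections *)

(* The group, its action and the quadratic space are kept abstract because
   unification is intractable on concrete matrix groups. *)
Section Reflections.

Local Open Scope group_scope.

Variables (F : fieldType) (V : lmodType F) (q : V -> F) (b : V -> V -> F).
Implicit Types (v w x y : V).
Hypothesis sq1 : forall t : F, t != 0%R -> (t * t = 1)%R.
Hypothesis qD : forall v w, q (v + w)%R = (q v + q w + b v w)%R.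
Hypothesis qZ : forall a v, q (a *: v)%R = (a ^+ 2 * q v)%R.
Hypothesis bC : forall v w, b v w = b w v.
Hypothesis bDl : forall u v w, b (u + v)%R w = (b u w + b v w)%R.
Hypothesis bZl : forall a v w, b (a *: v)%R w = (a * b v w)%R.
Hypothesis bxx : forall v, b v v = (2%:R * q v)%R.
Hypothesis b_nondeg : forall v, v != 0%R -> exists w, b v w != 0%R.

Variables (gT : finGroupType) (act : gT -> V -> V) (O : {group gT}).
Hypothesis act1 : forall v, act 1 v = v.
Hypothesis actM : forall g h v, act (g * h) v = act h (act g v).
Hypothesis actD : forall g v w, act g (v + w)%R = (act g v + act g w)%R.
Hypothesis actZ : forall g a v, act g (a *: v)%R = (a *: act g v)%R.
Hypothesis act_inj : forall g h, act g =1 act h -> g = h.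
Hypothesis act_q : forall g, (forall v, q (act g v) = q v) <-> g \in O.

Variable r : V -> gT.
Hypothesis act_r : forall x w, q x = (-1)%R ->
  act (r x) w = (w + b w x *: x)%R.

Lemma isometry_q g v : g \in O -> q (act g v) = q v.
Proof. by move=> /act_q. Qed.

Lemma isometry_b g v w : g \in O -> b (act g v) (act g w) = b v w.
Proof.
move=> gO; apply: (@addrI _ (q v + q w)%R).
by rewrite -qD -(isometry_q v gO) -(isometry_q w gO) -qD -actD isometry_q.
Qed.

Lemma actKV g : cancel (act g^-1) (act g).
Proof. by move=> v; rewrite -actM mulVg act1. Qed.

Lemma bZr a v w : b v (a *: w)%R = (a * b v w)%R.
Proof. by rewrite bC bZl bC. Qed.

Lemma center_neq0 x : q x = (-1)%R -> x != 0%R.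
Proof.
move=> qx; apply: contra_eq_neq qx => ->.
by rewrite -(scale0r 0%R) qZ expr0n mul0r eq_sym oppr_eq0 oner_eq0.
Qed.

Lemma reflK x : q x = (-1)%R -> r x * r x = 1.
Proof.
move=> qx; apply: act_inj => w; rewrite actM act1 !act_r //.
rewrite bDl bZl bxx qx -addrA -scalerDl.
have -> : (b w x + (b w x + b w x * (2%:R * -1)) = 0)%R by ring.
by rewrite scale0r addr0.
Qed.

Lemma reflV x : q x = (-1)%R -> (r x)^-1 = r x.
Proof. by move=> qx; apply: (mulgI (r x)); rewrite mulgV reflK. Qed.

Lemma refl_isometry x : q x = (-1)%R -> r x \in O.
Proof.
move=> qx; apply/act_q => w; rewrite act_r // qD qZ qx bZr; ring.
Qed.

Lemma reflJ x g : q x = (-1)%R -> g \in O -> r x ^ g = r (act g x).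
Proof.
move=> qx gO; apply: act_inj => w.
rewrite conjgE !actM !act_r ?isometry_q // actD actZ actKV.
by rewrite -(isometry_b _ x gO) actKV.
Qed.

Lemma reflZ x (c : F) : q x = (-1)%R -> (c * c = 1)%R -> r (c *: x)%R = r x.
Proof.
move=> qx c1; apply: act_inj => w.
rewrite !act_r ?qZ ?qx ?expr2 ?c1 ?mul1r //.
by rewrite bZr scalerA mulrAC c1 mul1r.
Qed.

Lemma refl_eq x y : q x = (-1)%R -> q y = (-1)%R ->
  (r x == r y) = proportional x y.
Proof.
move=> qx qy; apply/eqP/proportionalP => [rxy|[c c1 ->]]; last by rewrite reflZ.
have y0 := center_neq0 qy; have x0 := center_neq0 qx.
have [w xw] := b_nondeg x0; rewrite bC in xw.
have := act_r w qx; rewrite rxy act_r // => /addrI.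
(* Scaling by [b w x], which is its own inverse, isolates [x]. *)
move=> /(congr1 (fun v => b w x *: v)%R).
rewrite !scalerA (sq1 xw) scale1r; move: (b w x * b w y)%R => c xE.
have c1 : (c * c = 1)%R.
  by apply: sq1; apply: contraNneq x0 => c0; rewrite -xE c0 scale0r.
by exists c; rewrite // -[in RHS]xE scalerA c1 scale1r.
Qed.

Lemma refl_commute x y : q x = (-1)%R -> q y = (-1)%R -> b x y = 0%R ->
  r x ^ r y = r x.
Proof.
by move=> qx qy xy; rewrite reflJ ?refl_isometry // act_r // xy scale0r addr0.
Qed.

(* [b x y] is a square root of 1, so [y + (b x y) x] is [b x y] times
   [x + (b x y) y]. *)
Lemma refl_braid x y : q x = (-1)%R -> q y = (-1)%R -> b x y != 0%R ->
  r x ^ r y = r y ^ r x.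
Proof.
move=> qx qy xy; have qxy : q (act (r y) x) = (-1)%R.
  by rewrite isometry_q // refl_isometry.
rewrite !reflJ ?refl_isometry // act_r // in qxy *.
rewrite (act_r y qx) [b y x]bC.
have -> : (y + b x y *: x = b x y *: (x + b x y *: y))%R.
  by rewrite scalerDr scalerA sq1 // scale1r addrC.
by rewrite reflZ // sq1.
Qed.

(** By the braid relation this product is itself a commutator. Elements central in the derived
    subgroup can therefore be tested against products of reflections. *)
Lemma refl_mul_derived x y : q x = (-1)%R -> q y = (-1)%R -> b x y != 0%R ->
  r x * r y \in [~: O, O].
Proof.
move=> qx qy xy; suff -> : r x * r y = [~ r y, r x].
  by apply: mem_commg; apply: refl_isometry.
by rewrite commgEl -refl_braid // conjgE reflV // !mulgA reflK // mul1g.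
Qed.

(** Auxiliary centers for [refl_mul_center]: a reflection commuting with two given ones, a link
    between two reflections, and a vector telling [x] from [y]. The counts on the quadric supply all
    three. *)
Hypothesis ex_perp2 : forall x y, q x = (-1)%R -> q y = (-1)%R ->
  ~~ proportional x y -> exists a, [/\ q a = (-1)%R, b x a = 0%R & b y a = 0%R].
Hypothesis ex_nonperp2 : forall x y, q x = (-1)%R -> q y = (-1)%R ->
  ~~ proportional x y ->
  exists a, [/\ q a = (-1)%R, b x a != 0%R & b y a != 0%R].
Hypothesis ex_separating : forall x y, q x = (-1)%R -> q y = (-1)%R ->
  ~~ proportional x y ->
  exists a, [/\ q a = (-1)%R, b x a != 0%R, b y a = 0%R & ~~ proportional x a].

Let Z := 'Z([~: O, O]).

(* If z centralizes [r a * r b] then the commutators [r a, z] and [r b, z]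
   agree; so for z central all [r a, z] are equal, and trivial when
   z = r x * r y since some a is orthogonal to x and y.  Thus z commutes with all
   reflections. *)
Lemma refl_mul_center x y : q x = (-1)%R -> q y = (-1)%R ->
  r x * r y \in Z -> proportional x y.
Proof.
move=> qx qy zZ; apply: contraT => xy.
have cz z a c : z \in Z -> q a = (-1)%R -> q c = (-1)%R -> b a c != 0%R ->
    r a * r a ^ z = r c * r c ^ z.
  move=> {}zZ qa qc ac; have ra_c := refl_mul_derived qa qc ac.
  have : (r a * r c) ^ z = r a * r c.
    by apply/conjg_fixP/commgP/commute_sym; case/centerP: zZ => _; apply.
  rewrite conjMg => E; apply: (mulIg (r c ^ z)).
  rewrite -[LHS]mulgA E -[RHS]mulgA -conjMg reflK // conj1g mulg1.
  by rewrite [LHS]mulgA reflK // mul1g.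
have czT z a c : z \in Z -> q a = (-1)%R -> q c = (-1)%R ->
    r a * r a ^ z = r c * r c ^ z.
  move=> {}zZ qa qc; have [ac|nac] := boolP (proportional a c).
    by have /eqP -> : r a == r c by rewrite refl_eq.
  have [d [qd ad cd]] := ex_nonperp2 qa qc nac.
  by rewrite (cz z a d) // (cz z c d).
set z := r x * r y in zZ.
have fixz c : q c = (-1)%R -> r c ^ z = r c.
  move=> qc; have [a [qa xa ya]] := ex_perp2 qx qy xy.
  have aE : r a ^ z = r a.
    by rewrite conjgM !refl_commute // bC.
  by apply: (mulgI (r c)); rewrite -(czT z a c) // aE !reflK.
(* Here [r a] commutes with [r x * r y] and with [r y], hence with [r x]. As [a] and [x] are not
   orthogonal, the braid relation then forces [r x = r a], a contradiction. *)
have [a [qa xa ya nxa]] := ex_separating qx qy xy.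
have ax : r a ^ r x = r a.
  apply: (conjg_inj (r y)); rewrite -conjgM -/z fixz //.
  by rewrite refl_commute // bC.
have := refl_braid qx qa xa; rewrite ax => /(canRL (conjgK _)).
rewrite conjgE invgK mulgA mulgK => rxa.
by rewrite -refl_eq // rxa eqxx in nxa.
Qed.

Lemma center_derived_normal : Z <| O.
Proof. exact: char_normal_trans (center_char _) (der_normal 1 O). Qed.

Lemma refl_normZ x : q x = (-1)%R -> r x \in 'N(Z).
Proof.
move=> qx; apply: (subsetP (normal_norm center_derived_normal)).
exact: refl_isometry.
Qed.

Lemma coset_refl_eq x y : q x = (-1)%R -> q y = (-1)%R ->
  (coset Z (r x) == coset Z (r y)) = proportional x y.
Proof.
move=> qx qy; apply/eqP/idP => [cxy|]; last first.
  by rewrite -refl_eq // => /eqP ->.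
apply: refl_mul_center => //.
apply: coset_idr; first by rewrite groupM ?refl_normZ.
rewrite morphM ?refl_normZ //= -/Z cxy -morphM ?refl_normZ //= reflK //.
exact: morph1.
Qed.

(** Orthogonal centers give commuting involutions, whose product has order at most 2. Otherwise the
    braid relation makes the cube trivial, and the order is 3 unless the product dies in the
    quotient, which happens only for proportional centers. *)
Lemma adj_coset_refl x y : q x = (-1)%R -> q y = (-1)%R ->
  adj (coset Z (r x)) (coset Z (r y)) = (b x y != 0%R) && ~~ proportional x y.
Proof.
move=> qx qy; rewrite /adj -morphM ?refl_normZ //=; set g := r x * r y.
have gN : g \in 'N(Z) by rewrite groupM ?refl_normZ.
have [xy0|xy0] := eqVneq (b x y) 0%R.
  have g2 : g ^+ 2 = 1.
    have := refl_commute qy qx; rewrite bC => /(_ xy0).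
    rewrite conjgE reflV // mulgA => xyx.
    by rewrite expgS expg1 /g mulgA xyx reflK.
  apply/negbTE; have : #[coset Z g] %| 2.
    by rewrite order_dvdn -morphX //= g2 morph1.
  by apply: contraL => /eqP ->.
have g3 : coset Z g ^+ 3 = 1.
  rewrite -morphX //= (_ : g ^+ 3 = 1) ?morph1 //.
  have := refl_braid qy qx; rewrite bC => /(_ xy0).
  rewrite !conjgE !reflV // => xyx.
  have reflKl u h : q u = (-1)%R -> r u * (r u * h) = h.
    by move=> qu; rewrite mulgA reflK // mul1g.
  by rewrite 2!expgS expg1 /g -!mulgA -xyx !reflKl ?reflK.
have g1 : (coset Z g == 1) = proportional x y.
  rewrite -coset_refl_eq // morphM ?refl_normZ //= -eq_invg_mul.
  by rewrite -morphV ?refl_normZ //= reflV.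
have [xy|nxy] := boolP (proportional x y).
  by move: g1; rewrite xy => /eqP ->; rewrite order1.
by rewrite (nt_prime_order _ g3) // g1.
Qed.

End Reflections.

(** * Reflections as invertible matrices *)

Section MatrixReflections.

Local Open Scope group_scope.

Variable q : nat.
Local Notation V := 'rV['F_q]_(4 + 4).
Local Notation GL8 := {'GL_8['F_q]}.
Implicit Types (g h : GL8) (v w x y : V).

Lemma act8_1 v : act8 (1 : GL8) v = v.
Proof. exact: mulmx1. Qed.

Lemma act8M g h v : act8 (g * h) v = act8 h (act8 g v).
Proof. exact: mulmxA. Qed.

Lemma act8D g v w : act8 g (v + w)%R = (act8 g v + act8 g w)%R.
Proof. exact: mulmxDl. Qed.

Lemma act8Z g (a : 'F_q) v : act8 g (a *: v)%R = (a *: act8 g v)%R.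
Proof. by rewrite /act8 -scalemxAl. Qed.

Lemma act8_inj g h : act8 g =1 act8 h -> g = h.
Proof.
by move=> gh; apply/val_inj/row_matrixP => i; rewrite !rowE; apply: gh.
Qed.

Lemma GO8_Q g : (forall v, Q (act8 g v) = Q v) <-> g \in GO8 q.
Proof.
by rewrite inE; split=> [gQ | /forallP gQ v]; [apply/forallP => v|]; apply/eqP.
Qed.

Lemma GO8_group_set : group_set (GO8 q).
Proof.
apply/group_setP; split=> [|g h /GO8_Q gQ /GO8_Q hQ]; apply/GO8_Q => v.
  by rewrite act8_1.
by rewrite act8M hQ.
Qed.

Definition GO8_group : {group GL8} := Group GO8_group_set.

Definition refl_mx x : 'M['F_q]_(4 + 4) :=
  (1%:M + (\col_i form (delta_mx 0 i) x) *m x)%R.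

Lemma mul_refl_mx x w : (w *m refl_mx x = w + form w x *: x)%R.
Proof.
rewrite mulmxDr mulmx1 mulmxA; congr (_ + _)%R.
rewrite [(w *m _)%R]mx11_scalar mul_scalar_mx; congr (_ *: _)%R.
rewrite mxE [in RHS](row_sum_delta w).
rewrite (big_morph (fun v => form v x) (fun u v => formDl u v x) (form0l x)).
by apply: eq_bigr => i _; rewrite mxE formZl.
Qed.

(** The default 1 is never reached when [Q x] is -1: the matrix is then its own inverse. *)
Definition refl x : GL8 := insubd (1 : GL8) (refl_mx x : 'M_8.-1.+1).

Lemma refl_mxK x : Q x = (-1)%R -> (refl_mx x *m refl_mx x = 1%:M)%R.
Proof.
move=> Qx; apply/row_matrixP => i; rewrite !rowE mulmxA !mul_refl_mx mulmx1.
rewrite formDl formZl formxx Qx -addrA -scalerDl.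
set c := form _ x; rewrite (_ : c + (c + _) = 0)%R ?scale0r ?addr0 //; ring.
Qed.

Lemma act8_refl x w : Q x = (-1)%R -> act8 (refl x) w = (w + form w x *: x)%R.
Proof.
move=> Qx; rewrite -mul_refl_mx /act8; congr (_ *m _)%R.
by rewrite -[LHS]/(val (refl x)) insubdK //; case/mulmx1_unit: (refl_mxK Qx).
Qed.

Lemma reflections_refl : (forall x, reflection_center x = (Q x == (-1)%R)) ->
  reflections q = [set refl x | x in sphere q].
Proof.
move=> centerE; apply/setP => g; rewrite inE; apply/existsP/imsetP.
  move=> [x]; rewrite centerE => /andP[/eqP Qx /forallP gx]; exists x.
    by rewrite inE Qx.
  apply: act8_inj => w; rewrite (eqP (gx w)) (act8_refl _ Qx) Qx.
  by rewrite invrN1 mulrN1 scaleNr opprK.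
move=> [x]; rewrite inE => /eqP Qx ->; exists x.
rewrite centerE Qx eqxx /=; apply/forallP => w; apply/eqP.
by rewrite (act8_refl _ Qx) invrN1 mulrN1 scaleNr opprK.
Qed.

End MatrixReflections.

(** * Existence of the auxiliary centers by counting *)

Section SphereGeometry.

Local Open Scope ring_scope.

Variables (q n c c0 c1 : nat).
Local Notation V := 'rV['F_q]_(4 + 4).
Implicit Types x y : V.
Hypothesis counts : sphere_counts q n c c0 c1.

(** Inclusion-exclusion, written with sums so that no truncated subtraction occurs; the next counts
    follow the same pattern. *)
Lemma card_perp_ptsU x y : Q x = -1 -> Q y = -1 -> ~~ proportional x y ->
  (#|perp_pts x :|: perp_pts y| + (if form x y == 0%R then c0 else c1) =
   c + c)%N.
Proof.
have [_ Hc Hcc] := counts; move=> Qx Qy xy; rewrite -(Hcc x y) //.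
have -> : perp_pts2 x y = perp_pts x :&: perp_pts y.
  by apply/setP => z; rewrite !inE; case: (Q z == -1).
by rewrite cardsUI !Hc.
Qed.

Lemma card_nonperp x : Q x = -1 ->
  (#|[set z in sphere q | form x z != 0%R]| + c = n)%N.
Proof.
have [<- Hc _] := counts; move=> /Hc <-.
rewrite addnC -(cardsID [set z | form x z == 0] (sphere q)); congr (_ + _)%N.
  by apply: eq_card => z; rewrite !inE.
by apply: eq_card => z; rewrite !inE andbC.
Qed.

Lemma card_nonperp2 x y : Q x = -1 -> Q y = -1 -> ~~ proportional x y ->
  (#|[set z in sphere q | (form x z != 0%R) && (form y z != 0%R)]| + (c + c) =
   n + (if form x y == 0%R then c0 else c1))%N.
Proof.
move=> Qx Qy xy; have [<- _ _] := counts.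
rewrite -(card_perp_ptsU Qx Qy xy) addnA; congr (_ + _)%N.
rewrite addnC -(cardsID (perp_pts x :|: perp_pts y) (sphere q)).
congr (_ + _)%N; apply: eq_card => z; rewrite !inE.
  by case: (Q z == -1).
by case: (Q z == -1); rewrite ?andbF //= andbT negb_or.
Qed.

Lemma ex_perp2 x y : (0 < c0)%N -> (0 < c1)%N ->
  Q x = -1 -> Q y = -1 -> ~~ proportional x y ->
  exists z, [/\ Q z = -1, form x z = 0 & form y z = 0].
Proof.
have [_ _ Hcc] := counts; move=> ? ? Qx Qy xy.
have : (0 < #|perp_pts2 x y|)%N by rewrite Hcc //; case: ifP.
by case/card_gt0P => z; rewrite inE => /and3P[/eqP ? /eqP ? /eqP ?]; exists z.
Qed.

Lemma ex_nonperp2 x y : (c + c < n + c0)%N -> (c + c < n + c1)%N ->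
  Q x = -1 -> Q y = -1 -> ~~ proportional x y ->
  exists z, [/\ Q z = -1, form x z != 0 & form y z != 0].
Proof.
move=> ? ? Qx Qy xy.
have : (0 < #|[set z in sphere q | (form x z != 0%R) && (form y z != 0%R)]|)%N.
  by have := card_nonperp2 Qx Qy xy; case: ifP => _; lia.
by case/card_gt0P => z; rewrite !inE => /and3P[/eqP ? ? ?]; exists z.
Qed.

Lemma ex_separating x y : (c0 + 2 < c)%N -> (c1 + 2 < c)%N ->
  Q x = -1 -> Q y = -1 -> ~~ proportional x y ->
  exists z,
    [/\ Q z = -1, form x z != 0, form y z = 0 & ~~ proportional x z].
Proof.
have [_ Hc Hcc] := counts; move=> ? ? Qx Qy xy.
(* Of the [c] points orthogonal to [y], at most [c0] or [c1] are also orthogonal to [x], and at most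
   two lie on the line of [x]. *)
suff /card_gt0P[z] : (0 < #|perp_pts y :\: (perp_pts2 x y :|: [set x; - x])|)%N.
  rewrite !inE => /and3P[nz /eqP Qz /eqP yz].
  by move: nz; rewrite Qz yz !eqxx andbT negb_or => /andP[xz xnz]; exists z.
have := cardsD (perp_pts y) (perp_pts2 x y :|: [set x; - x]).
have : (#|perp_pts y :&: (perp_pts2 x y :|: [set x; - x])| <=
    #|perp_pts2 x y| + 2)%N.
  apply: leq_trans (subset_leq_card (subsetIr _ _)) _.
  by apply: leq_trans (leq_card_setU _ _) _; rewrite leq_add2l cards2; case: eqP.
by rewrite (Hcc x y) // Hc //; case: ifP => _; lia.
Qed.

End SphereGeometry.

(** * From points of the quadric to a strongly regular graph *)

Section StronglyRegular.

Local Open Scope ring_scope.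

(** The parameters [n], [k], [l], [m] are the customary v, k, lambda, mu. *)
Definition strongly_regular (gT : finGroupType) (D : {set gT}) (n k l m : nat) :=
  [/\ #|D| = n,
      {in D, forall d, #|[set e in D | adj d e]| = k}
    & {in D &, forall d e, d != e ->
        #|[set f in D | adj d f && adj e f]| = if adj d e then l else m}].

Variables (q n c c0 c1 : nat).
Local Notation V := 'rV['F_q]_(4 + 4).
Implicit Types x y z : V.
Hypothesis counts : sphere_counts q n c c0 c1.

(** Each vertex stands for [h] points of the quadric, [s] of which are not orthogonal to a chosen
    one of them. These [s] points must be discarded when non-orthogonal points are used to count
    neighbours, a vertex not being its own neighbour. *)
Variables h s : nat.
Hypothesis card_line : forall x, Q x = -1 -> #|[set y | proportional x y]| = h.
Hypothesis card_line_nonperp : forall x, Q x = -1 ->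
  #|[set y | proportional x y && (form x y != 0)]| = s.

Variables (gT : finGroupType) (r : V -> gT).
Hypothesis r_eq : forall x y, Q x = -1 -> Q y = -1 ->
  (r x == r y) = proportional x y.
Hypothesis r_adj : forall x y, Q x = -1 -> Q y = -1 ->
  adj (r x) (r y) = (form x y != 0) && ~~ proportional x y.

Lemma proportional_sphere x y : Q x = -1 -> proportional x y -> Q y = -1.
Proof.
by move=> Qx /proportionalP[a a1 ->]; rewrite QZ Qx expr2 a1 mul1r.
Qed.

Lemma card_preim_lines (P : pred gT) :
  (h * #|[set d in r @: sphere q | P d]| =
   #|[set x in sphere q | P (r x)]|)%N.
Proof.
rewrite -[RHS]sum1_card (partition_big r (mem [set d in r @: sphere q | P d])).
  rewrite mulnC -sum_nat_const; apply: eq_bigr => d.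
  rewrite inE => /andP[/imsetP[x]]; rewrite inE => /eqP Qx -> Prx.
  rewrite -(card_line Qx) -sum1_card; apply: eq_bigl => y.
  rewrite !inE; case: (eqVneq (Q y) (-1)) => [Qy|Qy] /=.
    rewrite eq_sym r_eq //; case xy: (proportional x y); rewrite ?andbF ?andbT //.
    by have /eqP <- : r x == r y by rewrite r_eq.
  by apply/negbTE; apply: contraNN Qy => /(proportional_sphere Qx) ->.
by move=> x; rewrite !inE => /andP[Qx ->]; rewrite imset_f ?inE.
Qed.

Lemma card_adj x : Q x = -1 ->
  (h * #|[set d in r @: sphere q | adj (r x) d]| + s + c = n)%N.
Proof.
move=> Qx; rewrite -(card_nonperp counts Qx) card_preim_lines; congr (_ + _)%N.
rewrite -(card_line_nonperp Qx) addnC.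
rewrite -(cardsID [set y | proportional x y] [set z in sphere q | form x z != 0%R]).
congr (_ + _)%N; apply: eq_card => y; rewrite !inE.
  case xy: (proportional x y); rewrite ?andbF ?andbT //=.
  by rewrite (proportional_sphere Qx xy) eqxx.
case: (eqVneq (Q y) (-1)) => [Qy|_]; last by rewrite andbF.
by rewrite r_adj //= andbC.
Qed.

Lemma card_adj2 x y : Q x = -1 -> Q y = -1 -> ~~ proportional x y ->
  (h * #|[set d in r @: sphere q | adj (r x) d && adj (r y) d]| +
    (if form x y == 0%R then 0 else s + s) + (c + c) =
   n + (if form x y == 0%R then c0 else c1))%N.
Proof.
move=> Qx Qy xy; rewrite -(card_nonperp2 counts Qx Qy xy) card_preim_lines.
congr (_ + _)%N; set A := [set z in _ | _ && (form y z != 0%R)].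
(* [L x y] and [L y x] are the points non-orthogonal to both centers that represent [r x] or [r y]
   themselves; they are counted in [A] but give no common neighbour. *)
pose L (u v : V) : {set V} := [set z : V |
  proportional u z && (form u z != 0%R) && (form v z != 0%R)].
have LE u v : Q u = -1 -> #|L u v| = (if form u v == 0%R then 0 else s)%N.
  move=> Qu; rewrite /L; case: ifP => uv.
    apply: eq_card0 => z; rewrite !inE; apply/negP => /andP[/andP[/proportionalP]].
    by move=> [a _ ->] _; rewrite formZr formC (eqP uv) mulr0 eqxx.
  rewrite -(card_line_nonperp Qu); apply: eq_card => z; rewrite !inE.
  case: proportionalP => // -[a a1 ->]; rewrite !formZr !mulf_eq0.
  have /negPf -> : a != 0.
    by apply: contra_eq_neq a1 => ->; rewrite mul0r eq_sym oner_neq0.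
  by rewrite [form v u]formC uv andbT.
rewrite addnC -(cardsID (L x y :|: L y x) A); congr (_ + _)%N.
  have /setIidPr -> : L x y :|: L y x \subset A.
    apply/subsetP => z; rewrite !inE.
    case/orP => /andP[/andP[zp -> ->]]; rewrite !andbT ?andTb.
      by rewrite (proportional_sphere Qx zp).
    by rewrite (proportional_sphere Qy zp).
  rewrite cardsU !LE // [form y x]formC disjoint_setI0; last first.
    apply/pred0P => z; rewrite !inE; apply/negP => /andP[/andP[/andP[xz _] _]].
    case/andP => /andP[yz _] _; case/negP: xy; move: xz yz.
    move=> /proportionalP[a a1 ->] /proportionalP[b b1].
    move=> /(congr1 (fun v => b *: v)); rewrite !scalerA b1 scale1r => <-.
    by apply/proportionalP; exists (b * a); rewrite // mulrACA a1 b1 mulr1.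
  by rewrite cards0 subn0; case: ifP.
apply: eq_card => z; rewrite !inE.
case: (eqVneq (Q z) (-1)) => //= [Qz|_]; last by rewrite andbF.
rewrite !r_adj // negb_or.
by case: (form x z == 0); case: (form y z == 0); rewrite ?andbF // !andbT.
Qed.

Lemma line_sphere_strongly_regular n' k l m :
  (h * n' = n)%N -> (h * k + s + c = n)%N ->
  (h * l + (s + s) + (c + c) = n + c1)%N -> (h * m + (c + c) = n + c0)%N ->
  (0 < h)%N -> strongly_regular (r @: sphere q) n' k l m.
Proof.
have [Hn _ _] := counts; move=> n'E kE lE mE h0.
have hI a a' : (h * a = h * a')%N -> a = a'.
  by move/eqP; rewrite eqn_pmul2l // => /eqP.
split.
- apply: hI; rewrite n'E -Hn.
  transitivity (h * #|[set d in r @: sphere q | predT d]|)%N.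
    by congr (_ * _)%N; apply: eq_card => d; rewrite [in RHS]inE andbT.
  by rewrite card_preim_lines; apply: eq_card => x; rewrite inE andbT.
- move=> d /imsetP[x]; rewrite inE => /eqP Qx ->; apply: hI.
  by have := card_adj Qx; lia.
move=> d e /imsetP[x]; rewrite inE => /eqP Qx -> /imsetP[y].
rewrite inE => /eqP Qy -> xy; apply: hI.
have {}xy : ~~ proportional x y by rewrite -r_eq.
have := card_adj2 Qx Qy xy; rewrite r_adj // xy andbT.
by case: ifP => _ /=; lia.
Qed.

End StronglyRegular.

(** * Strong regularity of the reflections modulo the center *)

Section ReflectionClass.

Local Open Scope group_scope.

Variables (q n c c0 c1 h s : nat).
Local Notation V := 'rV['F_q]_(4 + 4).
Hypothesis sq1 : forall t : 'F_q, t != 0%R -> (t * t = 1)%R.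
Hypothesis centerE : forall x : V, reflection_center x = (Q x == (-1)%R).
Hypothesis counts : sphere_counts q n c c0 c1.
Hypotheses (c0_gt0 : 0 < c0) (c1_gt0 : 0 < c1).
Hypotheses (c0_lt : c0 + 2 < c) (c1_lt : c1 + 2 < c).
Hypotheses (lt_n0 : c + c < n + c0) (lt_n1 : c + c < n + c1).
Hypothesis card_line : forall x : V, Q x = (-1)%R ->
  #|[set y | proportional x y]| = h.
Hypothesis card_line_nonperp : forall x : V, Q x = (-1)%R ->
  #|[set y | proportional x y && (form x y != 0)%R]| = s.

Lemma reflections_quotient :
  reflections q / 'Z(Omega8 q) =
  [set coset 'Z(Omega8 q) (refl x) | x in sphere q].
Proof.
have sub : reflections q \subset 'N('Z(Omega8 q)).
  apply: subset_trans (normal_norm (center_derived_normal (GO8_group q))).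
  rewrite reflections_refl //; apply/subsetP => _ /imsetP[x + ->].
  rewrite inE => /eqP Qx; apply/GO8_Q => w.
  by rewrite (act8_refl _ Qx) QD QZ Qx formZr; ring.
rewrite /quotient morphimEsub // reflections_refl // -imset_comp.
exact: eq_imset.
Qed.

Lemma reflections_strongly_regular n' k l m :
  (h * n' = n)%N -> (h * k + s + c = n)%N ->
  (h * l + (s + s) + (c + c) = n + c1)%N -> (h * m + (c + c) = n + c0)%N ->
  0 < h -> strongly_regular (reflections q / 'Z(Omega8 q)) n' k l m.
Proof.
move=> n'E kE lE mE h0; rewrite reflections_quotient.
have p2 x y := @ex_perp2 _ _ _ _ _ counts x y c0_gt0 c1_gt0.
have np2 x y := @ex_nonperp2 _ _ _ _ _ counts x y lt_n0 lt_n1.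
have sep x y := @ex_separating _ _ _ _ _ counts x y c0_lt c1_lt.
apply: (line_sphere_strongly_regular counts card_line card_line_nonperp) => //.
  exact: (coset_refl_eq sq1 (@QD q) (@QZ q) (@formC q) (@formDl q) (@formZl q)
   (@formxx q) (@form_nondeg q) (@act8_1 q) (@act8M q) (@act8D q) (@act8Z q)
   (@act8_inj q) (@GO8_Q q : forall g, _ <-> g \in GO8_group q) (@act8_refl q)
   p2 np2 sep).
exact: (adj_coset_refl sq1 (@QD q) (@QZ q) (@formC q) (@formDl q) (@formZl q)
   (@formxx q) (@form_nondeg q) (@act8_1 q) (@act8M q) (@act8D q) (@act8Z q)
   (@act8_inj q) (@GO8_Q q : forall g, _ <-> g \in GO8_group q) (@act8_refl q)
   p2 np2 sep).
Qed.

End ReflectionClass.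

(** In characteristic 2, x = -x and (x, x) = 0, so a line carries one point, orthogonal to
    itself. *)
Lemma reflections_strongly_regular_2 :
  strongly_regular (reflections 2 / 'Z(Omega8 2))%g 120 56 28 24.
Proof.
have propE (x y : 'rV['F_2]_(4 + 4)) : proportional x y = (y == x).
  rewrite /proportional (_ : - x = x)%R ?orbb //.
  by rewrite -scaleN1r (_ : -1 = 1 :> 'F_2)%R ?scale1r //; apply: val_inj.
apply: (reflections_strongly_regular sq1_F2 _ sphere_counts_F2
  (h := 1) (s := 0)) => // [x | x Qx | x Qx].
- by rewrite /reflection_center /=; elim/F2P: (Q x).
- by apply: etrans (cards1 x); apply: eq_card => y; rewrite !inE propE.
apply: eq_card0 => y; rewrite !inE propE; case: eqP => // ->.
by rewrite formxx Qx.
Qed.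

(** A line carries the two points x and -x, and (x, x) = 1, so neither is orthogonal to x. *)
Lemma reflections_strongly_regular_3 :
  strongly_regular (reflections 3 / 'Z(Omega8 3))%g 1080 728 484 504.
Proof.
have line (x y : 'rV['F_3]_(4 + 4)) : Q x = (-1)%R ->
  (proportional x y && (form x y != 0)%R) = proportional x y.
  move=> Qx; case: proportionalP => // -[a a1 ->]; rewrite formZr formxx Qx.
  by move: a a1; apply: F3P.
have cline (x : 'rV['F_3]_(4 + 4)) : Q x = (-1)%R ->
    #|[set y | proportional x y]| = 2.
  move=> Qx; transitivity #|[set x; - x]%R|.
    by apply: eq_card => y; rewrite !inE.
  rewrite cards2; suff -> : (x != - x)%R by [].
  rewrite -addr_eq0 -mulr2n -scaler_nat scaler_eq0 negb_or.
  by rewrite (sphere_neq0 Qx).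
apply: (reflections_strongly_regular sq1_F3 _ sphere_counts_F3
  (h := 2) (s := 2)) => // [x | x Qx].
- by rewrite /reflection_center /= formxx; elim/F3P: (Q x).
by apply: etrans (cline x Qx); apply: eq_card => y; rewrite !inE line.
Qed.

(** * Spectra *)

Section Spectrum.

Local Open Scope ring_scope.

Lemma prod_four_values (T : eqType) (R : comPzSemiRingType) (f : T -> R)
    (a b c d : T) (t : seq T) :
  uniq [:: a; b; c; d] -> {subset t <= [:: a; b; c; d]} ->
  \prod_(x <- t) f x = f a ^+ count_mem a t * f b ^+ count_mem b t *
    f c ^+ count_mem c t * f d ^+ count_mem d t.
Proof.
rewrite /= !inE !negb_or andbT -!andbA.
case/and5P => ab ac ad bc /andP[bd cd].
elim: t => [|x t IH] xt; first by rewrite big_nil !mulr1.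
rewrite big_cons IH => [|y yt]; last by apply: xt; rewrite inE yt orbT.
have /= := xt x (mem_head _ _); rewrite !inE.
by case/or4P => /eqP -> /=; rewrite eqxx ?(negPf ab) ?(negPf ac) ?(negPf ad)
  ?(negPf bc) ?(negPf bd) ?(negPf cd) ?[b == a]eq_sym ?[c == a]eq_sym
  ?[d == a]eq_sym ?[c == b]eq_sym ?[d == b]eq_sym ?[d == c]eq_sym ?(negPf ab)
  ?(negPf ac) ?(negPf ad) ?(negPf bc) ?(negPf bd) ?(negPf cd) !add0n add1n exprS;
  rewrite ?[_ * f x]mulrC; ring.
Qed.

Lemma sum_four_values (T : eqType) (R : comPzRingType) (f : T -> R)
    (a b c d : T) (t : seq T) :
  uniq [:: a; b; c; d] -> {subset t <= [:: a; b; c; d]} ->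
  \sum_(x <- t) f x = f a *+ count_mem a t + f b *+ count_mem b t +
    f c *+ count_mem c t + f d *+ count_mem d t.
Proof.
rewrite /= !inE !negb_or andbT -!andbA.
case/and5P => ab ac ad bc /andP[bd cd].
elim: t => [|x t IH] xt; first by rewrite big_nil !mulr0n !addr0.
rewrite big_cons IH => [|y yt]; last by apply: xt; rewrite inE yt orbT.
have /= := xt x (mem_head _ _); rewrite !inE.
by case/or4P => /eqP -> /=; rewrite eqxx ?(negPf ab) ?(negPf ac) ?(negPf ad)
  ?(negPf bc) ?(negPf bd) ?(negPf cd) ?[b == a]eq_sym ?[c == a]eq_sym
  ?[d == a]eq_sym ?[c == b]eq_sym ?[d == b]eq_sym ?[d == c]eq_sym ?(negPf ab)
  ?(negPf ac) ?(negPf ad) ?(negPf bc) ?(negPf bd) ?(negPf cd) !add0n add1n mulrSr;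
  ring.
Qed.

Lemma char_poly_conj (R : comUnitRingType) n (U B : 'M[R]_n) : U \in unitmx ->
  char_poly (invmx U *m B *m U) = char_poly B.
Proof.
move=> Uu; rewrite /char_poly /char_poly_mx.
pose Up := map_mx polyC U; pose Vp := map_mx polyC (invmx U).
have VU : Vp *m Up = 1%:M by rewrite -map_mxM mulVmx // map_mx1.
rewrite !map_mxM -/Up -/Vp.
have -> : 'X%:M - Vp *m map_mx polyC B *m Up = Vp *m ('X%:M - map_mx polyC B) *m Up.
  by rewrite mulmxBr mulmxBl scalar_mxC -[_ *m Vp *m Up]mulmxA VU mulmx1.
by rewrite !det_mulmx mulrAC -det_mulmx VU det1 mul1r.
Qed.

(** [A] stands for the adjacency matrix of the join and [P] for the same-fibre matrix. The
    hypotheses express that the span of 1, [A], [P], [J] contains [A *m J], [A *m P] and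
    [A *m A]. *)
Variables (N n k l m : nat) (A P : 'M[algC]_N) (r s : int).
Let J : 'M[algC]_N := const_mx 1.
Hypothesis A_sym : A^T = A.
Hypothesis A_real : A \is a mxOver Num.real.
Hypothesis AJ : A *m J = (k + 2 * n)%:R *: J.
Hypothesis AP : A *m P = (k%:R - n%:R) *: P + n%:R *: J.
Variables al be : int.
Hypothesis A2 : A *m A =
  (k%:R - m%:R)%:M + (l%:R - m%:R) *: A + al%:~R *: P + be%:~R *: J.
Hypothesis rs_sum : r + s = l%:Z - m%:Z.
Hypothesis rs_prod : r * s = m%:Z - k%:Z.

(** An eigenvector for a value other than the first is killed by [J]; if the value also differs from
    the second, it is killed by [P]. The identity for [A *m A] then becomes a quadratic equation for
    [a] with roots r and s. *)
Lemma eigenvalue_four (a : algC) (u : 'rV_N) : u != 0 -> u *m A = a *: u ->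
  a \in [:: (k + 2 * n)%:R; k%:R - n%:R; r%:~R; s%:~R].
Proof.
move=> u0 uA; rewrite !inE; have [//|a0] := eqVneq a (k + 2 * n)%:R.
have uJ : u *m J = 0.
  apply/eqP; have := congr1 (mulmx u) AJ; rewrite mulmxA uA -scalemxAl.
  rewrite -scalemxAr => /eqP; rewrite -subr_eq0 -scalerBl scaler_eq0.
  by rewrite subr_eq0 (negPf a0).
have [//|a1] := eqVneq a (k%:R - n%:R).
have uP : u *m P = 0.
  apply/eqP; have := congr1 (mulmx u) AP; rewrite mulmxA uA -scalemxAl.
  rewrite mulmxDr -!scalemxAr uJ scaler0 addr0.
  by move=> /eqP; rewrite -subr_eq0 -scalerBl scaler_eq0 subr_eq0 (negPf a1).
have := congr1 (mulmx u) A2.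
rewrite mulmxA uA -scalemxAl uA !mulmxDr -!scalemxAr uA uJ uP !scaler0 !addr0.
rewrite mul_mx_scalar !scalerA -scalerDl => /eqP.
rewrite -subr_eq0 -scalerBl scaler_eq0 (negPf u0) orbF => /eqP E.
have E1 : (r%:~R + s%:~R : algC) = l%:R - m%:R.
  by rewrite -rmorphD rs_sum rmorphB.
have E2 : (r%:~R * s%:~R : algC) = m%:R - k%:R.
  by rewrite -rmorphM rs_prod rmorphB.
suff : (a - r%:~R) * (a - s%:~R) == 0 by rewrite mulf_eq0 !subr_eq0.
apply/eqP; rewrite -{}E.
transitivity (a * a - (r%:~R + s%:~R) * a + r%:~R * s%:~R); first by ring.
by rewrite E1 E2; ring.
Qed.

Hypothesis trA : \tr A = 0.
Hypothesis albe : al + be = m%:Z + (2 * n)%:Z.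
Hypothesis trP : \tr P = N%:R.

Let trJ : \tr J = N%:R.
Proof.
rewrite /mxtrace (eq_bigr (fun=> 1)) => [|i _]; last by rewrite mxE.
by rewrite sumr_const card_ord.
Qed.

Let trA2 : \tr (A *m A) = N%:R * (k + 2 * n)%:R.
Proof.
have alE : al%:~R = m%:R + (2 * n)%:R - be%:~R :> algC.
  have /(congr1 (fun z : int => z%:~R : algC)) := albe; rewrite !rmorphD /=.
  by move=> /(canRL (addrK _)).
rewrite A2 !linearD /= !linearZ /= mxtrace_scalar trA trP trJ alE.
rewrite -mulr_natr natrD /=; ring.
Qed.

Let trA3 : \tr (A *m A *m A) =
  ((l%:Z - m%:Z + be) * (k + 2 * n)%:Z + al * k%:Z)%:~R * N%:R.
Proof.
rewrite -mulmxA A2 !mulmxDr -!scalemxAr AJ AP mul_mx_scalar.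
rewrite !(mxtraceD, mxtraceZ) trA trA2 trP trJ.
rewrite !(rmorphD, rmorphM, rmorphB) /=; ring.
Qed.

(** A real symmetric matrix is unitarily diagonalizable, so the traces of its powers are the power
    sums of its eigenvalues. Grouping equal eigenvalues turns them into integer equations for the
    multiplicities. *)
Lemma spectrum_four :
  uniq [:: (k + 2 * n)%:Z; k%:Z - n%:Z; r; s] ->
  exists n0 n1 n2 n3 : nat,
  [/\ (n0 + n1 + n2 + n3 = N)%N,
      n0%:Z * (k + 2 * n)%:Z + n1%:Z * (k%:Z - n%:Z) + n2%:Z * r + n3%:Z * s = 0,
      n0%:Z * (k + 2 * n)%:Z ^+ 2 + n1%:Z * (k%:Z - n%:Z) ^+ 2 +
        n2%:Z * r ^+ 2 + n3%:Z * s ^+ 2 = N%:Z * (k + 2 * n)%:Z,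
      n0%:Z * (k + 2 * n)%:Z ^+ 3 + n1%:Z * (k%:Z - n%:Z) ^+ 3 +
        n2%:Z * r ^+ 3 + n3%:Z * s ^+ 3 =
      ((l%:Z - m%:Z + be) * (k + 2 * n)%:Z + al * k%:Z) * N%:Z
    & char_poly A = ('X - (k + 2 * n)%:R%:P) ^+ n0 *
        ('X - (k%:R - n%:R)%:P) ^+ n1 * ('X - r%:~R%:P) ^+ n2 *
        ('X - s%:~R%:P) ^+ n3].
Proof.
move=> uni.
have {}uni : uniq ([:: (k + 2 * n)%:R; k%:R - n%:R; r%:~R; s%:~R] : seq algC).
  rewrite -(map_inj_uniq (@intr_inj algC)) /= rmorphB /= in uni.
  exact: uni.
have /orthomx_spectralP : A \is normalmx.
  apply: symmetric_normalmx => //.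
  by rewrite is_hermitianmxE expr0 scale1r A_sym map_mx_id.
set U := spectralmx A; set B := spectral_diag A => AE.
have Uu : U \in unitmx := spectral_unit A.
pose t := [seq B 0 i | i <- enum 'I_N].
have tsub : {subset t <= [:: (k + 2 * n)%:R; k%:R - n%:R; r%:~R; s%:~R]}.
  (* The rows of the diagonalizing matrix are eigenvectors, nonzero because it is invertible. *)
  move=> _ /mapP[i _ ->]; apply: (@eigenvalue_four _ (row i U)).
    apply: contraTneq Uu => Ui0; rewrite -row_free_unit.
    apply/negP => /row_freeP[U' UU']; have := congr1 (row i) UU'.
    rewrite row_mul Ui0 mul0mx => /rowP/(_ i); rewrite !mxE eqxx.
    by move/eqP; rewrite eq_sym oner_eq0.
  rewrite -row_mul {1}AE !mulmxA mulmxV // mul1mx mul_diag_mx.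
  by apply/rowP => j; rewrite !mxE.
have trE (M : 'M_N) : \tr (invmx U *m M *m U) = \tr M.
  by rewrite mxtrace_mulC mulKVmx.
have AAE : A *m A = invmx U *m (diag_mx B *m diag_mx B) *m U.
  by rewrite AE !mulmxA mulmxK.
have AAAE : A *m A *m A = invmx U *m (diag_mx B *m diag_mx B *m diag_mx B) *m U.
  by rewrite AAE [in X in _ *m X]AE !mulmxA mulmxK.
have sumE (f : algC -> algC) : \sum_(x <- t) f x = \sum_i f (B 0 i).
  by rewrite big_map big_enum.
have S0 : \sum_(x <- t) 1 = N%:R :> algC.
  by rewrite (sumE (fun=> 1)) sumr_const card_ord.
have S1 : \sum_(x <- t) x = 0.
  by rewrite (sumE id) -[RHS]trA AE trE mxtrace_diag.
have S2 : \sum_(x <- t) x ^+ 2 = N%:R * (k + 2 * n)%:R.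
  rewrite (sumE (fun x => x ^+ 2)) -trA2 AAE trE mulmx_diag mxtrace_diag.
  by apply: eq_bigr => i _; rewrite mxE expr2.
have S3 : \sum_(x <- t) x ^+ 3 =
    ((l%:Z - m%:Z + be) * (k + 2 * n)%:Z + al * k%:Z)%:~R * N%:R.
  rewrite (sumE (fun x => x ^+ 3)) -trA3 AAAE trE !mulmx_diag mxtrace_diag.
  by apply: eq_bigr => i _; rewrite !mxE !exprS expr0 mulr1 mulrA.
have chiE : char_poly A = \prod_(x <- t) ('X - x%:P).
  rewrite AE char_poly_conj // char_poly_trig ?diag_mx_is_trig //.
  by rewrite big_map big_enum; apply: eq_bigr => i _; rewrite !mxE eqxx mulr1n.
rewrite (prod_four_values _ uni tsub) in chiE.
move: S0 S1 S2 S3; rewrite !(sum_four_values _ uni tsub).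
set n0 := count_mem _ _; set n1 := count_mem _ _.
set n2 := count_mem _ _; set n3 := count_mem _ _ => S0 S1 S2 S3.
exists n0, n1, n2, n3; split => //.
- by apply/eqP; rewrite -(eqr_nat algC) !natrD -S0.
- apply: (@intr_inj algC); rewrite -[RHS]S1 !(rmorphD, rmorphM, rmorphB) /=; ring.
- apply: (@intr_inj algC); rewrite [RHS]rmorphM /= -[RHS]S2.
  rewrite !(rmorphD, rmorphM, rmorphB, rmorphXn) /=; ring.
apply: (@intr_inj algC); rewrite [RHS]rmorphM /= -[RHS]S3.
rewrite !(rmorphD, rmorphM, rmorphB, rmorphXn) /=; ring.
Qed.

End Spectrum.

(** * The join of three strongly regular graphs *)

Section Tripartite.

Local Open Scope ring_scope.

Variables (gT : finGroupType) (D : {set gT}) (T : eqType) (tau : gT -> T).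
Variables (n k l m : nat).
Let fib d := [set e in D | tau e == tau d].
Hypothesis cardD : #|D| = (3 * n)%N.
Hypothesis adj_irr : {in D, forall d, adj d d = false}.
Hypothesis fib_regular : {in D, forall d, strongly_regular (fib d) n k l m}.
Hypothesis adj_cross : {in D &, forall d e, tau d != tau e -> adj d e}.

Lemma adjC (d e : gT) : adj d e = adj e d.
Proof. by rewrite /adj -(orderJ (d * e)%g d) conjgE -mulgA mulKg. Qed.

Lemma card_other d : d \in D -> #|[set f in D | tau f != tau d]| = (2 * n)%N.
Proof.
move=> dD; have [nE _ _] := fib_regular dD.
have := cardsID (fib d) D; rewrite (setIidPr _) ?nE ?cardD; last first.
  by apply/subsetP => f; rewrite inE => /andP[].
move=> E; suff -> : [set f in D | tau f != tau d] = D :\: fib d by lia.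
by apply/setP => f; rewrite !inE; case: (f \in D); rewrite /= ?andbT.
Qed.

Lemma card_adj_fib d e : d \in D -> e \in D ->
  #|[set f in D | adj d f && (tau f == tau e)]| =
  (if tau d == tau e then k else n)%N.
Proof.
move=> dD eD; have [nE kE _] := fib_regular eD; case: eqP => [de|/eqP de].
  rewrite -(kE d) ?inE ?dD ?de ?eqxx //; apply: eq_card => f.
  by rewrite !inE; case: (f \in D) => //=; rewrite andbC.
rewrite -nE; apply: eq_card => f; rewrite !inE.
case fD: (f \in D) => //=; case: eqP => [fe|]; rewrite ?andbF // andbT.
by rewrite adj_cross // fe.
Qed.

Lemma card_nbr d : d \in D -> #|[set f in D | adj d f]| = (k + 2 * n)%N.
Proof.
move=> dD; rewrite -(cardsID [set f | tau f == tau d]) -(card_other dD).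
have := card_adj_fib dD dD; rewrite eqxx => <-; congr (_ + _)%N.
  by apply: eq_card => f; rewrite !inE andbA.
apply: eq_card => f; rewrite !inE.
case fD: (f \in D); rewrite ?andbF //=; case: eqP => //= /eqP fd.
by rewrite adj_cross // eq_sym.
Qed.

(** Vertices of one fibre share their common neighbours inside it and both other fibres entirely.
    For different fibres the common neighbours are the k neighbours of [d] in its fibre, the k
    neighbours of [e] in its fibre, and the whole third fibre. *)
Lemma card_nbr2 d e : d \in D -> e \in D ->
  #|[set f in D | adj d f && adj f e]| =
  (if tau d == tau e then
     (if d == e then k else if adj d e then l else m) + 2 * n
   else k + k + n)%N.
Proof.
move=> dD eD; have [nE kE lE] := fib_regular dD.
rewrite -(cardsID [set f | tau f == tau d]); case: eqP => [de|/eqP de].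
  rewrite -(card_other dD); congr (_ + _)%N.
    case: eqVneq => [<-|d_e].
      have dd : d \in fib d by rewrite inE dD eqxx.
      rewrite -(kE d dd); apply: eq_card => f; rewrite !inE.
      by rewrite [adj f d]adjC andbb andbAC.
    rewrite -lE ?inE ?dD ?eD ?de ?eqxx //; apply: eq_card => f; rewrite !inE.
    by rewrite [adj f e]adjC de andbAC.
  apply: eq_card => f; rewrite !inE.
  case fD: (f \in D); rewrite ?andbF //=; case: eqP => //= /eqP fd.
  by rewrite !adj_cross // ?[tau d == _]eq_sym // -de.
rewrite -addnA; congr (_ + _)%N.
  have := card_adj_fib dD dD; rewrite eqxx => <-; apply: eq_card => f.
  rewrite !inE; case fD: (f \in D); rewrite //= -andbA; congr (_ && _).
  by case: eqP => [fd|]; rewrite ?andbF // adj_cross // fd.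
rewrite -(cardsID [set f | tau f == tau e]); congr (_ + _)%N.
  have := card_adj_fib eD eD; rewrite eqxx => <-; apply: eq_card => f.
  rewrite !inE; case fD: (f \in D); rewrite ?andbF //= [adj f e]adjC.
  case: (eqVneq (tau f) (tau e)) => [fe|]; rewrite ?andbF //= !andbT.
  by rewrite fe [tau e == _]eq_sym de adj_cross // fe.
have [n'E _ _] := fib_regular eD.
have := cardsID (fib e) [set f in D | tau f != tau d].
rewrite card_other // (_ : _ :&: fib e = fib e) ?n'E; last first.
  apply/setIidPr/subsetP => f; rewrite !inE => /andP[-> /eqP ->].
  by rewrite eq_sym.
move=> E; suff <- : [set f in D | tau f != tau d] :\: fib e =
    [set f in D | adj d f && adj f e] :\: [set f | tau f == tau d]
     :\: [set f | tau f == tau e] by lia.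
apply/setP => f; rewrite !inE; case fD: (f \in D); rewrite ?andbF //=.
case: (eqVneq (tau f) (tau e)) => //= fe; case: (eqVneq (tau f) (tau d)) => //= fd.
by rewrite !adj_cross // eq_sym.
Qed.

Lemma sum_enum_val (p : pred gT) :
  \sum_(i < #|D|) (p (enum_val i))%:R = #|[set f in D | p f]|%:R :> algC.
Proof.
rewrite -(big_enum_val (fun f => (p f)%:R : algC)) /=.
rewrite -sum1dep_card big_mkcondr natr_sum; apply: eq_bigr => f _.
by case: (p f).
Qed.

Lemma tripartite_spectrum (r s : int) :
  r + s = l%:Z - m%:Z -> r * s = m%:Z - k%:Z ->
  uniq [:: (k + 2 * n)%:Z; k%:Z - n%:Z; r; s] ->
  exists n0 n1 n2 n3 : nat,
  [/\ (n0 + n1 + n2 + n3 = 3 * n)%N,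
      n0%:Z * (k + 2 * n)%:Z + n1%:Z * (k%:Z - n%:Z) + n2%:Z * r + n3%:Z * s = 0,
      n0%:Z * (k + 2 * n)%:Z ^+ 2 + n1%:Z * (k%:Z - n%:Z) ^+ 2 +
        n2%:Z * r ^+ 2 + n3%:Z * s ^+ 2 = (3 * n)%:Z * (k + 2 * n)%:Z,
      n0%:Z * (k + 2 * n)%:Z ^+ 3 + n1%:Z * (k%:Z - n%:Z) ^+ 3 +
        n2%:Z * r ^+ 3 + n3%:Z * s ^+ 3 =
      ((2 * k + n)%:Z * (k + 2 * n)%:Z +
        (n%:Z + l%:Z - (2 * k)%:Z) * k%:Z) * (3 * n)%:Z
    & char_poly (adjmx D) = ('X - (k + 2 * n)%:R%:P) ^+ n0 *
        ('X - (k%:R - n%:R)%:P) ^+ n1 * ('X - r%:~R%:P) ^+ n2 *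
        ('X - s%:~R%:P) ^+ n3].
Proof.
move=> rs_sum rs_prod uni.
have evD (i : 'I_#|D|) : enum_val i \in D := enum_valP i.
pose P : 'M[algC]_#|D| :=
  \matrix_(i, j) (tau (enum_val i) == tau (enum_val j))%:R.
(* Comparing entries of [A *m A]: a pair from different fibres requires l - m + be = 2k + n, and a
   nonadjacent pair of distinct vertices in one fibre requires al + be = m + 2n. *)
pose be : int := (2 * k + n)%:Z - l%:Z + m%:Z.
pose al : int := n%:Z + l%:Z - (2 * k)%:Z.
have sym : (adjmx D)^T = adjmx D by apply/matrixP => i j; rewrite !mxE adjC.
have real : adjmx D \is a mxOver Num.real.
  by apply/mxOverP => i j; rewrite mxE realn.
have AJ : adjmx D *m const_mx 1 =
    (k + 2 * n)%:R *: const_mx 1 :> 'M[algC]_#|D|.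
  apply/matrixP => i j; rewrite !mxE -(card_nbr (evD i)) -sum_enum_val mulr1.
  by apply: eq_bigr => x _; rewrite !mxE mulr1.
have AP : adjmx D *m P = (k%:R - n%:R) *: P + n%:R *: const_mx 1.
  apply/matrixP => i j; rewrite !mxE mulr1.
  transitivity (#|[set f in D | adj (enum_val i) f &&
                    (tau f == tau (enum_val j))]|%:R : algC).
    by rewrite -sum_enum_val; apply: eq_bigr => x _; rewrite !mxE -natrM mulnb.
  by rewrite card_adj_fib //; case: eqP => _ /=; ring.
have A2 : adjmx D *m adjmx D = (k%:R - m%:R)%:M + (l%:R - m%:R) *: adjmx D +
    al%:~R *: P + be%:~R *: const_mx 1.
  apply/matrixP => i j; rewrite !mxE mulr1.
  transitivity (#|[set f in D | adj (enum_val i) f &&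
                    adj f (enum_val j)]|%:R : algC).
    by rewrite -sum_enum_val; apply: eq_bigr => x _; rewrite !mxE -natrM mulnb.
  rewrite card_nbr2 // (inj_eq enum_val_inj).
  rewrite /al /be; have [<-|ij] := eqVneq i j.
    rewrite eqxx adj_irr //= !(rmorphD, rmorphB, rmorphM) /=; ring.
  case: eqP => [_|/eqP tij].
    by case: (adj _ _); rewrite /= !(rmorphD, rmorphB, rmorphM) /=; ring.
  rewrite adj_cross //= !(rmorphD, rmorphB, rmorphM) /=; ring.
have trA : \tr (adjmx D) = 0.
  by rewrite /mxtrace big1 // => i _; rewrite mxE adj_irr.
have albe : al + be = m%:Z + (2 * n)%:Z by rewrite /al /be; lia.
have trP : \tr P = #|D|%:R.
  rewrite /mxtrace (eq_bigr (fun=> 1)) => [|i _]; last by rewrite mxE eqxx.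
  by rewrite sumr_const card_ord.
have [n0 [n1 [n2 [n3 [E0 E1 E2 E3 E4]]]]] :=
  spectrum_four sym real AJ AP A2 rs_sum rs_prod trA albe trP uni.
exists n0, n1, n2, n3; split=> //; rewrite -?cardD // E3.
by congr ((_ * _ + _) * _); rewrite /be; ring.
Qed.

End Tripartite.

(** * The three fibres *)

Section GraphAutomorphisms.

Local Open Scope group_scope.
Implicit Type p : {perm 'I_4}.

Lemma node_cases (P : 'I_4 -> Prop) :
  P (node 0) -> P (node 1) -> P (node 2) -> P (node 3) -> forall i, P i.
Proof.
have nodeE j (lt_j : j < 4) : Ordinal lt_j = node j.
  by apply: val_inj; rewrite /= inordK.
by move=> P0 P1 P2 P3 [[|[|[|[|]]]]] //= lt_i; rewrite nodeE.
Qed.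

Lemma node_eq i j : i < 4 -> j < 4 -> (node i == node j) = (i == j).
Proof. by move=> lt_i lt_j; rewrite -val_eqE /= !inordK. Qed.

Lemma tperm_node i j k : i < 4 -> j < 4 -> k < 4 ->
  tperm (node i) (node j) (node k) =
  node (if k == i then j else if k == j then i else k).
Proof.
move=> i4 j4 k4; case: (eqVneq k i) => [->|ki]; first by rewrite tpermL.
case: (eqVneq k j) => [->|kj]; first by rewrite tpermR.
by rewrite tpermD // node_eq // eq_sym.
Qed.

Definition graph_transpositions : seq {perm 'I_4} :=
  [:: tperm (node 2) (node 3); tperm (node 0) (node 3); tperm (node 0) (node 2)].

Lemma AutD4E p : (p \in AutD4) = (p (node 1) == node 1).
Proof. by rewrite !inE sub1set inE. Qed.

Lemma AutD4_involution p : p \in AutD4 -> p * p = 1 -> p != 1 ->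
  p \in graph_transpositions.
Proof.
rewrite AutD4E => /eqP p1 pp np.
have pK i : p (p i) = i by rewrite -permM pp perm1.
have tE i j : p (node i) = node j -> p (node j) = node i.
  by move=> <-; apply: pK.
move E0: (p (node 0)) => x0; move E2: (p (node 2)) => x2.
move E3: (p (node 3)) => x3.
have := (pK (node 0), pK (node 2), pK (node 3)); rewrite E0 E2 E3.
have {}pE (t : {perm 'I_4}) : t (node 1) = node 1 -> t (node 0) = x0 ->
    t (node 2) = x2 -> t (node 3) = x3 -> p = t.
  move=> t1 t0 t2 t3; apply/permP; apply: node_cases; congruence.
move: x0 x2 x3 E0 E2 E3 pE.
(* There are 64 candidate images of the three outer nodes; being an involution that fixes the
   central node leaves the identity and the three transpositions. *)
do 3!apply: node_cases.
all: move=> E0 E2 E3 pE [[]]; rewrite ?E0 ?E2 ?E3 ?p1.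
all: try by move=> /eqP; rewrite node_eq.
all: try by move=> _ /eqP; rewrite node_eq.
all: try by move=> _ _ /eqP; rewrite node_eq.
all: move=> _ _ _.
all: try by case/eqP: np; apply: pE; rewrite perm1.
all: rewrite !inE.
all: apply/or3P.
all: first [apply: Or31; apply/eqP/pE; by rewrite ?tperm_node
  | apply: Or32; apply/eqP/pE; by rewrite ?tperm_node
  | apply: Or33; apply/eqP/pE; by rewrite ?tperm_node].
Qed.

Lemma graph_transpositions_uniq : uniq graph_transpositions.
Proof.
rewrite /= !inE negb_or -!andbA andbT; apply/and3P; split; apply/eqP.
all: move/permP/(_ (node 0)); rewrite !tperm_node //.
all: by move/eqP; rewrite node_eq.
Qed.

(** The product is a 3-cycle of the outer nodes, so its square still moves node 0. *)
Lemma mul_graph_transpositions p p' :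
  p \in graph_transpositions -> p' \in graph_transpositions -> p != p' ->
  p * p' * (p * p') != 1.
Proof.
rewrite !inE => /or3P[] /eqP-> /or3P[] /eqP->; rewrite ?eqxx // => _.
all: apply/eqP => /permP/(_ (node 0)) /eqP; apply/negP.
all: rewrite !permM perm1.
all: by rewrite !tperm_node // node_eq.
Qed.

Lemma graph_transpositions_neq1 p : p \in graph_transpositions -> p != 1.
Proof.
rewrite !inE => /or3P[] /eqP->; apply/eqP => /permP tE.
all: move/eqP: (tE (node 0)); move/eqP: (tE (node 2)).
all: by rewrite !perm1 !tperm_node // !node_eq.
Qed.

Lemma graph_transpositions_AutD4 p : p \in graph_transpositions -> p \in AutD4.
Proof.
rewrite AutD4E !inE => /or3P[] /eqP->.
all: by rewrite tperm_node.
Qed.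

(** Two distinct transpositions are exchanged by the third. *)
Lemma graph_transpositions_conj p p' :
  p \in graph_transpositions -> p' \in graph_transpositions ->
  exists2 s, s \in AutD4 & p ^ s = p'.
Proof.
move=> pT p'T; have [->|] := eqVneq p p'; first by exists 1; rewrite ?conjg1.
move: pT p'T; rewrite !inE => /or3P[] /eqP-> /or3P[] /eqP->; rewrite ?eqxx // => _.
all: first [exists (tperm (node 2) (node 3));
    [by rewrite graph_transpositions_AutD4 ?inE ?eqxx ?orbT
    |by rewrite tpermJ !tperm_node // tpermC]
  | exists (tperm (node 0) (node 3));
    [by rewrite graph_transpositions_AutD4 ?inE ?eqxx ?orbT
    |by rewrite tpermJ !tperm_node // tpermC]
  | exists (tperm (node 0) (node 2));
    [by rewrite graph_transpositions_AutD4 ?inE ?eqxx ?orbT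
    |by rewrite tpermJ !tperm_node // tpermC]].
Qed.

End GraphAutomorphisms.

(** * Transport along conjugation and injective morphisms *)

Section StronglyRegularImages.

Local Open Scope group_scope.

Lemma strongly_regular_conj (gT : finGroupType) (D : {set gT}) g n k l m :
  strongly_regular D n k l m -> strongly_regular (D :^ g) n k l m.
Proof.
have adjJ (d e : gT) : adj (d ^ g) (e ^ g) = adj d e.
  by rewrite /adj -conjMg orderJ.
have cardJ (p p' : pred gT) : (forall d, p' (d ^ g) = p d) ->
    #|[set d in D :^ g | p' d]| = #|[set d in D | p d]|.
  move=> pE; rewrite -(cardJg [set d in D | p d] g); apply: eq_card => d.
  rewrite !inE !mem_conjg inE; congr (_ && _).
  by rewrite -pE conjgKV.
case=> nE kE lE; split=> [|_ /imsetP[d dD ->]|].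
- by rewrite cardJg.
- by rewrite -(kE d dD); apply: cardJ => e; rewrite adjJ.
move=> _ _ /imsetP[d dD ->] /imsetP[e eD ->] de.
rewrite adjJ -lE //; last by apply: contraNneq de => ->.
by apply: cardJ => f; rewrite !adjJ.
Qed.

Lemma strongly_regular_injm (aT rT : finGroupType) (A : {group aT})
    (f : {morphism A >-> rT}) (D : {set aT}) n k l m :
  'injm f -> D \subset A ->
  strongly_regular D n k l m -> strongly_regular (f @* D) n k l m.
Proof.
move=> inj_f /[dup] /subsetP DA sDA; rewrite morphimEsub //.
have adjf : {in D &, forall d e, adj (f d) (f e) = adj d e}.
  by move=> d e /DA dA /DA eA; rewrite /adj -morphM // order_injm // groupM.
have injD : {in D &, injective f} by move=> d e /DA dA /DA eA; apply: (injmP inj_f).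
have cardf (p : pred aT) (p' : pred rT) : {in D, forall d, p' (f d) = p d} ->
    #|[set d in f @: D | p' d]| = #|[set d in D | p d]|.
  move=> pE; rewrite -(card_in_imset (f := f) (D := [set d in D | p d])).
    apply: eq_card => d; rewrite inE; apply/andP/imsetP.
      by case=> /imsetP[e eD ->]; rewrite pE // => pe; exists e; rewrite ?inE ?eD.
    by case=> e; rewrite inE => /andP[eD pe] ->; rewrite pE // imset_f.
  by move=> d e; rewrite !inE => /andP[dD _] /andP[eD _]; apply: injD.
case=> nE kE lE; split=> [|_ /imsetP[d dD ->]|].
- by rewrite card_in_imset.
- by rewrite -(kE d dD); apply: cardf => e eD; rewrite adjf.
move=> _ _ /imsetP[d dD ->] /imsetP[e eD ->] de.
rewrite adjf // -lE //; last by apply: contraNneq de => ->.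
by apply: cardf => g gD; rewrite !adjf.
Qed.

End StronglyRegularImages.

(** * The projection onto Sym(3) and its fibres on the class *)

Section Fibres.

Local Open Scope group_scope.

Variables (q : nat) (gT : finGroupType) (G : {group gT}).
Variables (E : POmega8_Sym3 q G) (D : {set gT}) (n k l m : nat).
Hypothesis D3 : three_transposition_group G D.
Hypothesis DE : reflection_class E D.
Hypothesis regular :
  strongly_regular (reflections q / 'Z(Omega8 q)) n k l m.
Hypothesis n_gt0 : 0 < n.

Local Notation N := (normal_part E).
Local Notation S := (graph_part E).
Local Notation gamE := (gam E).

Lemma gam_inj : 'injm gamE.
Proof. by case/isomP: (gam_isom E). Qed.

Lemma gam_im : gamE @* AutD4 = S.
Proof. by case/isomP: (gam_isom E). Qed.

(** [remgr N S d] is the factor of [d] in the complement; pulling it back along [gam] realizes the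
    quotient map by [N] with values in permutations of the nodes. *)
Definition graph_proj (d : gT) : {perm 'I_4} := invm gam_inj (remgr N S d).

Lemma mem_graph_part d : d \in G -> remgr N S d \in gamE @* AutD4.
Proof.
by move=> dG; rewrite gam_im mem_remgr //; case/sdprodP: (split_ext E) => _ ->.
Qed.

Lemma graph_projM : {in G &, {morph graph_proj : d e / d * e}}.
Proof.
move=> d e dG eG; have [nN _ _ _ _] := sdprod_context (split_ext E).
rewrite /graph_proj (remgrM (sdprod_compl (split_ext E)) nN) //.
by rewrite morphM ?mem_graph_part.
Qed.

Lemma graph_proj_AutD4 d : d \in G -> graph_proj d \in AutD4.
Proof.
move=> dG; have /morphimP[p pA _ pE] := mem_graph_part dG.
by rewrite /graph_proj pE invmE.
Qed.

Lemma graph_projE d : d \in G -> exists2 x, x \in N & d = x * gamE (graph_proj d).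
Proof.
move=> dG; exists (divgr N S d).
  by rewrite mem_divgr //; case/sdprodP: (split_ext E) => _ ->.
by rewrite [LHS](divgr_eq N S) /graph_proj invmK ?mem_graph_part.
Qed.

Lemma graph_proj_mul x p : x \in N -> p \in AutD4 -> graph_proj (x * gamE p) = p.
Proof.
move=> xN pA; have SE : gamE p \in S by rewrite -gam_im mem_morphim.
rewrite /graph_proj remgrMid ?invmE //.
by case/sdprodP: (split_ext E).
Qed.

Lemma gam_G p : p \in AutD4 -> gamE p \in G.
Proof.
move=> pA; have [_ /subsetP sSG _ _ _] := sdprod_context (split_ext E).
by apply: sSG; rewrite -gam_im mem_morphim.
Qed.

Lemma graph_proj_gam p : p \in AutD4 -> graph_proj (gamE p) = p.
Proof. by move=> pA; rewrite -[gamE p]mul1g graph_proj_mul. Qed.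

Lemma graph_proj_eq1 d : d \in G -> (graph_proj d == 1) = (d \in N).
Proof.
move=> dG; apply/eqP/idP => [d1 | dN].
  by have [x xN ->] := graph_projE dG; rewrite d1 morph1 mulg1.
by rewrite -[d]mulg1 -(morph1 gamE) graph_proj_mul.
Qed.

Lemma graph_projJ d g : d \in G -> g \in G ->
  graph_proj (d ^ g) = graph_proj d ^ graph_proj g.
Proof.
move=> dG gG; apply: (mulgI (graph_proj g)).
rewrite -graph_projM ?groupJ // !conjgE mulKVg graph_projM //.
by rewrite mulKVg.
Qed.

Lemma D_sub_G : D \subset G.
Proof. by case: D3 => _ <- _ _; apply: subset_gen. Qed.

Let DG d : d \in D -> d \in G. Proof. exact: (subsetP D_sub_G). Qed.

Lemma D_conj g : g \in G -> D :^ g = D.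
Proof.
case: D3 => /imsetP[d dG ->] _ _ _ gG; apply/normP.
by apply: (subsetP (class_norm d G)).
Qed.

Lemma D_involution d : d \in D -> d * d = 1.
Proof. by case: D3 => _ _ D2 _ /D2 d2; rewrite -(expg_order d) d2. Qed.

Lemma graph_proj_D d : d \in D -> graph_proj d \in graph_transpositions.
Proof.
move=> dD; apply: AutD4_involution; first by rewrite graph_proj_AutD4 ?DG.
  by rewrite -graph_projM ?DG // D_involution // -(morph1 gamE) graph_proj_gam.
apply/negP; rewrite graph_proj_eq1 ?DG // => dN.
have [nN sSG _ _ tiNS] := sdprod_context (split_ext E).
have sGN : G \subset N.
  (* If one element of the class lay in the normal subgroup [N], the whole class would, and so would
     the group it generates; the complement would be trivial. *)
  case: (D3) => /imsetP[c cG Dc] <- _ _; rewrite gen_subG Dc.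
  move: dD; rewrite Dc => /class_eqP <-.
  by rewrite class_sub_norm // normal_norm.
have S1 : S :=: 1 by apply/trivgP; rewrite -tiNS subsetI subxx (subset_trans sSG).
have tT : tperm (node 2) (node 3) \in graph_transpositions by rewrite inE eqxx.
have tA := graph_transpositions_AutD4 tT.
have : gamE (tperm (node 2) (node 3)) \in S by rewrite -gam_im mem_morphim.
rewrite S1 => /set1P t1; case/eqP: (graph_transpositions_neq1 tT).
by rewrite -(graph_proj_gam tA) t1 -(morph1 gamE) graph_proj_gam.
Qed.

Definition fibre p := [set d in D | graph_proj d == p].

(** An element of [D] in [N : Sym(2)] projects to a power of the transposition of nodes 2 and 3.
    That power is itself a transposition, hence the same one, so this fibre is the intersection
    described by [reflection_class]. *)
Lemma fibre_reflections :
  fibre (tperm (node 2) (node 3)) = psi E @* (reflections q / 'Z(Omega8 q)).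
Proof.
set t := tperm _ _; have tT : t \in graph_transpositions by rewrite inE eqxx.
have tA := graph_transpositions_AutD4 tT.
case: DE => _ <-; apply/setP => d; rewrite !inE psi_POmega8_Sym2.
case dD: (d \in D) => //=; have dG := DG dD.
have nN : <[gamE t]> \subset 'N(N).
  have [/normal_norm nNG _ _ _ _] := sdprod_context (split_ext E).
  by rewrite cycle_subG (subsetP nNG) // gam_G.
rewrite norm_joinEr //; apply/eqP/mulsgP => [dt | [x y xN /cycleP[i ->] dE]].
  by have [x xN ->] := graph_projE dG; exists x (gamE t); rewrite ?dt ?cycle_id.
have := graph_proj_D dD; rewrite dE -morphX // graph_proj_mul ?groupX //.
have t2 : t ^+ 2 = 1 by rewrite expgS expg1 tperm2.
have ti j : t ^+ j = if odd j then t else 1.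
  rewrite -{1}(odd_double_half j) expgD -mul2n expgM t2 expg1n mulg1.
  by case: (odd j).
by rewrite ti; case: (odd i) => // /graph_transpositions_neq1; rewrite eqxx.
Qed.

Lemma fibre_conj d g : d \in D -> g \in G ->
  fibre (graph_proj (d ^ g)) = fibre (graph_proj d) :^ g.
Proof.
move=> dD gG; apply/setP => e; rewrite mem_conjg inE [in RHS]inE.
have -> : (e ^ g^-1 \in D) = (e \in D) by rewrite -mem_conjg D_conj.
case eD: (e \in D); last by [].
move: (e ^ g^-1) (conjgKV g e) => h eE; rewrite !andTb.
have hG : h \in G by rewrite -(groupJr _ gG) eE DG.
have -> : graph_proj e = graph_proj h ^ graph_proj g.
  by rewrite -(graph_projJ hG gG) eE.
by rewrite (graph_projJ (DG dD) gG) (inj_eq (@conjg_inj _ (graph_proj g))).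
Qed.

Lemma D_neq0 : exists d, d \in fibre (tperm (node 2) (node 3)).
Proof.
rewrite fibre_reflections; apply/card_gt0P.
have sub : reflections q / 'Z(Omega8 q) \subset POmega8_Sym2 q.
  by rewrite quotientS // joing_subr.
by have [->] := strongly_regular_injm (psi_inj E) sub regular.
Qed.

(** The complement acts transitively on the three transpositions and normalizes [D], so each fibre
    is a conjugate of the fibre of reflections. *)
Lemma fibre_strongly_regular p : p \in graph_transpositions ->
  strongly_regular (fibre p) n k l m.
Proof.
move=> pT; have [d] := D_neq0; rewrite inE => /andP[dD /eqP dt].
have tT : tperm (node 2) (node 3) \in graph_transpositions by rewrite inE eqxx.
have [s sA <-] := graph_transpositions_conj tT pT.
have -> : tperm (node 2) (node 3) ^ s = graph_proj (d ^ gamE s).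
  by rewrite (graph_projJ (DG dD) (gam_G sA)) dt graph_proj_gam.
rewrite (fibre_conj dD (gam_G sA)).
apply: strongly_regular_conj; rewrite dt fibre_reflections.
apply: strongly_regular_injm regular; first exact: psi_inj.
by rewrite quotientS // joing_subr.
Qed.

Lemma card_D : #|D| = (3 * n)%N.
Proof.
rewrite -sum1_card.
rewrite (partition_big graph_proj (mem graph_transpositions)) => [|d dD]; last first.
  exact: graph_proj_D.
rewrite /= -big_uniq ?graph_transpositions_uniq //=.
rewrite (eq_big_seq (fun=> n)) => [|p pT].
  by rewrite big_const_seq count_predT iter_addn_0 mulnC.
by rewrite sum1dep_card; have [] := fibre_strongly_regular pT.
Qed.

Lemma adj_D_irr d : d \in D -> adj d d = false.
Proof. by move=> dD; rewrite /adj D_involution // order1. Qed.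

(* The graph projections of d and e generate Sym(3), so the product d * e
   projects to an element of order 3. *)
Lemma adj_D_cross d e : d \in D -> e \in D -> graph_proj d != graph_proj e ->
  adj d e.
Proof.
move=> dD eD de; have [_ _ _ /(_ d e dD eD)] := D3; rewrite /adj !inE.
suff d2 : (d * e) * (d * e) != 1.
  case/or3P=> // /eqP o; case/eqP: d2.
    by move/eqP: o; rewrite order_eq1 => /eqP ->; rewrite mulg1.
  by rewrite -(expg_order (d * e)) o.
have := mul_graph_transpositions (graph_proj_D dD) (graph_proj_D eD) de.
have deG : d * e \in G by rewrite groupM ?DG.
apply: contraNneq => dede.
by rewrite -graph_projM ?DG // -graph_projM // dede graph_proj_eq1 ?group1.
Qed.

End Fibres.

(** Solving for the multiplicities is left as a premise: once the parameters are numerals, the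
    equations are linear in [t0], [t1], [t2], [t3]. *)
Lemma reflection_class_spectrum (q : nat) (gT : finGroupType) (G : {group gT})
    (E : POmega8_Sym3 q G) (D : {set gT}) (n k l m : nat) (r s : int)
    (n1 n2 n3 : nat) :
  three_transposition_group G D -> reflection_class E D ->
  strongly_regular (reflections q / 'Z(Omega8 q))%g n k l m -> 0 < n ->
  (r + s = l%:Z - m%:Z)%R -> (r * s = m%:Z - k%:Z)%R ->
  (forall t0 t1 t2 t3 : nat, t0 + t1 + t2 + t3 = 3 * n ->
    (t0%:Z * (k + 2 * n)%:Z + t1%:Z * (k%:Z - n%:Z) + t2%:Z * r + t3%:Z * s = 0)%R ->
    (t0%:Z * (k + 2 * n)%:Z ^+ 2 + t1%:Z * (k%:Z - n%:Z) ^+ 2 +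
        t2%:Z * r ^+ 2 + t3%:Z * s ^+ 2 = (3 * n)%N%:Z * (k + 2 * n)%:Z)%R ->
    (t0%:Z * (k + 2 * n)%:Z ^+ 3 + t1%:Z * (k%:Z - n%:Z) ^+ 3 +
        t2%:Z * r ^+ 3 + t3%:Z * s ^+ 3 =
      ((2 * k + n)%N%:Z * (k + 2 * n)%:Z +
        (n%:Z + l%:Z - (2 * k)%N%:Z) * k%:Z) * (3 * n)%N%:Z)%R ->
    [/\ t0 = 1, t1 = n1, t2 = n2 & t3 = n3]) ->
  uniq [:: (k + 2 * n)%:Z; k%:Z - n%:Z; r; s]%R ->
  #|D| = 3 * n /\
  diagram_spectrum D (k + 2 * n)
    [:: ((k%:R - n%:R)%R, n1); (r%:~R%R, n2); (s%:~R%R, n3)].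
Proof.
move=> D3 DE reg n_gt0 rs_sum rs_prod solve uni.
have cD := card_D D3 DE reg n_gt0.
have irr d := @adj_D_irr _ _ _ D3 d.
have fib d : d \in D ->
    strongly_regular [set e in D | graph_proj E e == graph_proj E d] n k l m.
  move=> /(graph_proj_D E D3).
  exact: (fibre_strongly_regular D3 DE reg n_gt0).
have cross := @adj_D_cross _ _ _ E _ D3.
split=> //; split=> [d dD | ].
  exact: (card_nbr cD fib cross dD).
have [t0 [t1 [t2 [t3 [E0 E1 E2 E3 ->]]]]] :=
  tripartite_spectrum cD irr fib cross rs_sum rs_prod uni.
have [-> -> -> ->] := solve _ _ _ _ E0 E1 E2 E3.
by rewrite !big_cons big_nil /= expr1 mulr1 !mulrA.
Qed.

Theorem theorem6p22 :
  (forall (gT : finGroupType) (G : {group gT}) (E : POmega8_Sym3 2 G)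
      (D : {set gT}),
     three_transposition_group G D -> reflection_class E D ->
     #|D| = 360%N /\
     diagram_spectrum D 296
       [:: (- 64%:R, 2%N); (8%:R, 105%N); (- 4%:R, 252%N)]%R)
  /\
  (forall (gT : finGroupType) (G : {group gT}) (E : POmega8_Sym3 3 G)
      (D : {set gT}),
     three_transposition_group G D -> reflection_class E D ->
     #|D| = 3240%N /\
     diagram_spectrum D 2888
       [:: (- 352%:R, 2%N); (8%:R, 2457%N); (- 28%:R, 780%N)]%R).
Proof.
split=> gT G E D D3 DE.
  (* The eigenvalues are put in the forms k - n, with k = 56 and n = 120, and s = -4. *)
  have -> : (- 64%:R = 56%:R - 120%:R :> algC)%R by ring.
  have -> : (- 4%:R = (-4 : int)%:~R :> algC)%R by rewrite rmorphN.
  apply: (reflection_class_spectrum D3 DE reflections_strongly_regular_2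
    (r := 8) (s := -4)) => // t0 t1 t2 t3.
  (* Expanding the powers leaves numeral coefficients, hence a linear system. *)
  rewrite !exprS !expr0 => E0 E1 E2 E3; split; lia.
have -> : (- 352%:R = 728%:R - 1080%:R :> algC)%R by ring.
have -> : (- 28%:R = (-28 : int)%:~R :> algC)%R by rewrite rmorphN.
apply: (reflection_class_spectrum D3 DE reflections_strongly_regular_3
  (r := 8) (s := -28)) => // t0 t1 t2 t3.
rewrite !exprS !expr0 => E0 E1 E2 E3; split; lia.
Qed.
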